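(* Let $k$ be a positive integer, $\ell\in\{1,\dots,k\}$, and $j\leq k$ a nonnegative integer. Then $B_{\ell^{k+1-\ell}} f\in\Omega^{(k)}_{\max(j,\ell)}$ for every $f\in\Omega^{(k)}_j$.
   Context: For $n\in\mathbb Z$, $B_n=\sum_{i\ge0}s_{i+n}[X]\,s_i[X(t-1)]^\perp$ acting on symmetric functions over $\mathbb Q(q,t)$ ($f^\perp$ adjoint to multiplication by $f$ for the Hall scalar product; $s_i[X(t-1)]$ the plethystic substitution $p_n\mapsto(t^n-1)p_n$); for a partition $\mu$ of length $L$, $B_\mu=\prod_{1\le a<b\le L}(1-te_{ab})B_{\mu_1}\cdots B_{\mu_L}$ with $e_{ab}$ raising the $a$-th index by one and lowering the $b$-th by one. $\ell^{k+1-\ell}$ is the rectangular partition with $k+1-\ell$ parts equal to $\ell$. Main hook-length: $h_M(\mu)=\mu_1+\ell(\mu)-1$. $k$-split: for a partition $\mu$ with $\mu_1\le k$, $\mu^{\to k}=(\mu^{(1)},\dots,\mu^{(s)})$ is obtained by cutting $\mu$, without rearranging parts and starting from the largest parts, into consecutive blocks of rows $\mu^{(i)}$ with $h_M(\mu^{(i)})=k$ for $i<s$ (the last block may have smaller main hook-length). The $k$-split polynomials are $G^{(k)}_{()}=1$ and $G^{(k)}_\mu[X;t]=B_{\mu^{(1)}}G^{(k)}_{(\mu^{(2)},\mu^{(3)},\dots)}[X;t]$. For $0\le j\le k$, $\Omega^{(k)}_j$ is the linear span of $\{G^{(k)}_\mu[X;t]:\mu_1\le k,\ \mu_1=j\}$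 (the empty partition has first part $0$). *)

(* Defs.v *)
From HB Require Import structures.
From mathcomp Require Import all_boot all_order all_algebra.
From mathcomp Require Import finmap monalg.

Set Implicit Arguments.
Unset Strict Implicit.
Unset Printing Implicit Defensive.

Import GRing.Theory Num.Theory.
Local Open Scope ring_scope.
Local Open Scope fset_scope.

(* The monomial m stands for the power sum product p_m = \prod_i p_(i+1)^(m i):
   the variable of index i is the power sum of degree i+1. *)
Notation Lam F := {malg F[{cmonom nat}]}.

(* Q(q,t), as the fraction field of Q[q][t]. *)
Definition Qqt : fieldType := {fraction {poly {poly rat}}}.
Definition tvar : Qqt := tofrac 'X.

(* Meaningful for r > 0 only. *)
Definition psum (F : fieldType) (r : nat) : Lam F := << ucm r.-1 >>.

(* The complete homogeneous function h_n, which is the one-row Schur function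
   s_n, as the sum of p_lambda / z_lambda over the partitions lambda of n; the
   partition having m i parts equal to i+1 is encoded by m. *)
Definition hsym (F : fieldType) (n : nat) : Lam F :=
  \sum_(m : {ffun 'I_n -> 'I_n.+1} | (\sum_(i < n) i.+1 * m i)%N == n)
     ((\prod_(i < n) (i.+1 ^ m i * (m i)`!))%N%:R^-1 : F) *:
       \prod_(i < n) psum F i.+1 ^+ m i.

Definition hsymz (F : fieldType) (n : int) : Lam F :=
  if n is Posz n' then hsym F n' else 0.

(* m i is the multiplicity of i+1 as a part. *)
Definition zee (F : fieldType) (m : {cmonom nat}) : F :=
  \prod_(i <- finsupp m) (i.+1 ^ m i * (m i)`!)%N%:R.

Definition weight (m : {cmonom nat}) : nat :=
  (\sum_(i <- finsupp m) i.+1 * m i)%N.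

Definition degL (F : fieldType) (f : Lam F) : nat :=
  \max_(m <- msupp f) weight m.

Definition hall (F : fieldType) (f g : Lam F) : F :=
  \sum_(m <- msupp f) zee F m * f@_m * g@_m.

(* The expansion of the adjoint in the orthogonal basis (p_m), whose squared
   norms are the z_m; the finite set below contains all the m for which
   <g, f p_m> may be nonzero (see hall_perp and hall_inj). *)
Definition perp (F : fieldType) (f g : Lam F) : Lam F :=
  [malg m in [fset divcm n d | n in msupp g, d in msupp f] =>
     (zee F m)^-1 * hall g (f * << m >>)].

(* f[X(t-1)]. The scalars are left unchanged: this is only applied to
   functions with rational coefficients. *)
Definition plethXt1 (F : fieldType) (t : F) (f : Lam F) : Lam F :=
  mmap (in_alg (Lam F))
    (fun m : {cmonom nat} =>
       \prod_(i <- finsupp m) ((t ^+ i.+1 - 1) *: psum F i.+1) ^+ m i) f.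

(* The terms with i > degL f of the series vanish, see perp_hsym_gt. *)
Definition Bop (F : fieldType) (t : F) (n : int) (f : Lam F) : Lam F :=
  \sum_(i < (degL f).+1)
     hsymz F (Posz i + n) * perp (plethXt1 t (hsym F i)) f.

Definition Bword (F : fieldType) (t : F) (L : nat) (alpha : {ffun 'I_L -> int})
    (f : Lam F) : Lam F :=
  foldr (fun a => Bop t (alpha a)) f (enum 'I_L).

Definition eop (F : fieldType) (L : nat) (a b : 'I_L)
    (Phi : {ffun 'I_L -> int} -> Lam F) : {ffun 'I_L -> int} -> Lam F :=
  fun alpha =>
    Phi [ffun c => alpha c + (c == a)%:R - (c == b)%:R].

(* The e_ab act on the indices of the family alpha |-> B_alpha1 ... B_alphaL f,
   and the result is evaluated at mu; the e_ab commute, so that the order of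
   the factors is irrelevant. *)
Definition Bpart (F : fieldType) (t : F) (mu : seq nat) (f : Lam F) : Lam F :=
  let idx := ('I_(size mu) * 'I_(size mu))%type in
  foldr (fun (ab : idx) Phi alpha => Phi alpha - t *: eop ab.1 ab.2 Phi alpha)
        (fun alpha => Bword t alpha f)
        [seq ab : idx <- enum {: idx} | (ab.1 < ab.2)%N]
        [ffun a : 'I_(size mu) => Posz (nth 0%N mu a)].

Definition is_part (mu : seq nat) : bool := sorted geq mu && (0%N \notin mu).

Definition hookM (mu : seq nat) : nat := ((head 0 mu + size mu).-1)%N.

(* A block starting with a part x <= k has main hook-length k when it has
   k+1-x rows (see ksplitP). The first argument is recursion fuel. *)
Fixpoint ksplit_rec (fuel k : nat) (mu : seq nat) : seq (seq nat) :=
  match fuel, mu with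
  | fuel'.+1, x :: _ =>
      take (k.+1 - x) mu :: ksplit_rec fuel' k (drop (k.+1 - x) mu)
  | _, _ => [::]
  end.

Definition ksplit (k : nat) (mu : seq nat) : seq (seq nat) :=
  ksplit_rec (size mu) k mu.

Definition Gk (F : fieldType) (t : F) (k : nat) (mu : seq nat) : Lam F :=
  foldr (Bpart t) 1 (ksplit k mu).

Definition in_span (F : fieldType) (V : lmodType F) (P : V -> Prop) (f : V) :
    Prop :=
  exists s : seq (F * V),
    (forall cg, cg \in s -> P cg.2) /\ f = \sum_(cg <- s) cg.1 *: cg.2.

Definition Omega (F : fieldType) (t : F) (k j : nat) (f : Lam F) : Prop :=
  in_span (fun g => exists mu : seq nat,
             [/\ is_part mu, (head 0 mu <= k)%N, head 0%N mu = j
               & g = Gk t k mu]) f.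

Lemma Qqt_char0 : [pchar Qqt] =i pred0.
Proof.
apply/pcharf0P => n.
rewrite -[RHS](pnatr_eq0 rat) -(rmorph_nat (@tofrac {poly {poly rat}})).
by rewrite tofrac_eq0 -!polyC_natr !polyC_eq0.
Qed.

Lemma zee_neq0 (F : fieldType) (m : {cmonom nat}) :
  [pchar F] =i pred0 -> zee F m != 0.
Proof.
move/pcharf0P => F0; rewrite /zee prodf_seq_neq0.
by apply/allP => i _ /=; rewrite F0 -lt0n muln_gt0 expn_gt0 fact_gt0.
Qed.

Lemma hallEw (F : fieldType) (d : {fset {cmonom nat}}) (f g : Lam F) :
  msupp f `<=` d -> hall f g = \sum_(m <- d) zee F m * f@_m * g@_m.
Proof.
move=> le_fd; rewrite /hall (big_fset_incl _ le_fd) // => m _ mNf.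
by rewrite (mcoeff_outdom mNf) mulr0 mul0r.
Qed.

Lemma hallC (F : fieldType) (f g : Lam F) : hall f g = hall g f.
Proof.
rewrite (hallEw _ (fsubsetUl (msupp f) (msupp g))).
rewrite (hallEw _ (fsubsetUr (msupp f) (msupp g))).
by apply: eq_bigr => m _; rewrite mulrAC.
Qed.

Lemma hall_sumr (F : fieldType) (T : Type) (r : seq T) (f : Lam F)
    (c : T -> F) (g : T -> Lam F) :
  hall f (\sum_(x <- r) c x *: g x) = \sum_(x <- r) c x * hall f (g x).
Proof.
rewrite /hall; under [RHS]eq_bigr => x _ do rewrite mulr_sumr.
rewrite exchange_big; apply: eq_bigr => m _ /=.
rewrite raddf_sum mulr_sumr; apply: eq_bigr => x _ /=.
by rewrite mcoeffZ mulrCA.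
Qed.

Lemma hallU (F : fieldType) (f : Lam F) (m : {cmonom nat}) :
  hall f << m >> = zee F m * f@_m.
Proof.
rewrite hallC (hallEw _ msuppU_le) big_seq_fset1.
by rewrite mcoeffUU mulr1.
Qed.

Lemma hall_inj (F : fieldType) (f g : Lam F) : [pchar F] =i pred0 ->
  (forall h, hall f h = hall g h) -> f = g.
Proof.
move=> F0 fg; apply/malgP => m; apply: (mulfI (zee_neq0 m F0)).
by rewrite -!hallU fg.
Qed.

Lemma perpE (F : fieldType) (f g : Lam F) (m : {cmonom nat}) :
  (perp f g)@_m = (zee F m)^-1 * hall g (f * << m >>).
Proof.
rewrite /perp mcoeffE; case: ifPn => // mND.
rewrite /hall big_seq big1 ?mulr0 // => n ng.
apply/eqP; apply: contraNT mND; rewrite mulf_eq0 => /norP[_].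
rewrite mcoeff_neq0 => /msuppM_le[d [m' [df]]].
rewrite msuppU1 => /fset1P-> nE.
apply/imfset2P; exists n => //=; exists d => //=.
by apply/eqP/cmP => i; rewrite divcmE nE cmM addKn.
Qed.

Lemma hall_perp (F : fieldType) (f g h : Lam F) : [pchar F] =i pred0 ->
  hall (perp f g) h = hall g (f * h).
Proof.
move=> F0; have hE : h = \sum_(m <- msupp h) h@_m *: << m >>.
  rewrite {1}[h]monalgE; apply: eq_bigr => m _; apply/malgP => n.
  by rewrite mcoeffZ [X in _ * X]mcoeffU1 mulr_natr [LHS]mcoeffU.
have fhE : f * h = \sum_(m <- msupp h) h@_m *: (f * << m >>).
  rewrite {1}hE mulr_sumr; by apply: eq_bigr => m _; rewrite -scalerAr.
rewrite fhE {1}hE !hall_sumr; apply: eq_bigr => m _.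
by rewrite hallU perpE mulVKf ?zee_neq0.
Qed.

Definition homog (F : fieldType) (d : nat) (f : Lam F) : Prop :=
  forall m, m \in msupp f -> weight m = d.

Lemma weightEw (d : {fset nat}) (m : {cmonom nat}) : finsupp m `<=` d ->
  weight m = (\sum_(i <- d) i.+1 * m i)%N.
Proof.
move=> le_md; rewrite /weight (big_fset_incl _ le_md) // => i _.
by rewrite -cmE_eq0 => /eqP->; rewrite muln0.
Qed.

Lemma weightM (m n : {cmonom nat}) :
  weight (mulcm m n) = (weight m + weight n)%N.
Proof.
rewrite (@weightEw (finsupp m `|` finsupp n)) -?mdomD //.
rewrite mdomD (weightEw (fsubsetUl _ (finsupp n))).
rewrite (weightEw (fsubsetUr (finsupp m) _)) -big_split /=.
by apply: eq_bigr => i _; rewrite -mulnDr -cmM.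
Qed.

Lemma homogM (F : fieldType) (d e : nat) (f g : Lam F) :
  homog d f -> homog e g -> homog (d + e) (f * g).
Proof.
move=> hf hg m /msuppM_le[m1 [m2 [/hf <- /hg <- ->]]]; exact: weightM.
Qed.

Lemma homog1 (F : fieldType) : homog 0 (1 : Lam F).
Proof.
move=> m; rewrite -mcoeff_neq0 mcoeff1; case: (m =P mone) => [-> _|_].
  by rewrite /weight mdom1 big_nil.
by rewrite eqxx.
Qed.

Lemma homogZ (F : fieldType) (d : nat) (c : F) (f : Lam F) :
  homog d f -> homog d (c *: f).
Proof. by move=> hf m /(fsubsetP (msuppZ_le _ _)); apply: hf. Qed.

Lemma homog_sum (F : fieldType) (d : nat) (T : eqType) (r : seq T)
    (P : pred T) (G : T -> Lam F) :
  (forall x, x \in r -> P x -> homog d (G x)) ->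
  homog d (\sum_(x <- r | P x) G x).
Proof.
move=> hG m; rewrite big_seq_cond; elim/big_rec: _ => [|x f /andP[xr Px] IH].
  by rewrite msupp0.
move=> /(fsubsetP (msuppD_le _ _)); rewrite in_fsetU => /orP[|/IH//].
exact: hG.
Qed.

Lemma homog_prod (F : fieldType) (T : Type) (r : seq T) (d : T -> nat)
    (G : T -> Lam F) : (forall x, homog (d x) (G x)) ->
  homog (\sum_(x <- r) d x)%N (\prod_(x <- r) G x).
Proof.
move=> hG; elim/big_rec2: _ => [|x f e _ IH]; first exact: homog1.
exact: homogM.
Qed.

Lemma homogX (F : fieldType) (d n : nat) (f : Lam F) :
  homog d f -> homog (d * n) (f ^+ n).
Proof.
move=> hf; elim: n => [|n IH]; first by rewrite muln0; apply: homog1.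
by rewrite mulnS exprS; apply: homogM.
Qed.

Lemma homog_psum (F : fieldType) (i : nat) : homog i.+1 (psum F i.+1).
Proof.
move=> m; rewrite msuppU1 => /fset1P->.
by rewrite /weight mdomU big_seq_fset1 cmUU muln1.
Qed.

Lemma homog_hsym (F : fieldType) (n : nat) : homog n (hsym F n).
Proof.
apply: homog_sum => m _ /eqP wm; apply: homogZ; rewrite -[X in homog X]wm.
by apply: homog_prod => i; apply/homogX/homog_psum.
Qed.

Lemma homog_plethXt1 (F : fieldType) (t : F) (d : nat) (f : Lam F) :
  homog d f -> homog d (plethXt1 t f).
Proof.
move=> hf; apply: homog_sum => m /hf <- _.
rewrite mulr_algl; apply: homogZ; apply: homog_prod => i.
by apply/homogX/homogZ/homog_psum.
Qed.

Lemma perp_hsym_gt (F : fieldType) (t : F) (i : nat) (f : Lam F) :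
  (degL f < i)%N -> perp (plethXt1 t (hsym F i)) f = 0.
Proof.
move=> lt_fi; apply/malgP => m; rewrite perpE mcoeff0.
rewrite /hall big_seq big1 ?mulr0 // => n nf.
have [->|] := eqVneq ((plethXt1 t (hsym F i) * << m >>)@_n) 0.
  by rewrite mulr0.
rewrite mcoeff_neq0 => /msuppM_le[d [m' [df _ nE]]].
have: (weight n <= degL f)%N by apply: leq_bigmax_seq.
rewrite [n]nE [weight _]weightM (homog_plethXt1 (@homog_hsym F i) df) => le_f.
by have := leq_ltn_trans (leq_trans (leq_addr _ _) le_f) lt_fi; rewrite ltnn.
Qed.

Lemma ksplit_recP (fuel k : nat) (mu : seq nat) : (size mu <= fuel)%N ->
  is_part mu -> (head 0 mu <= k)%N ->
  let bs := ksplit_rec fuel k mu in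
  [/\ flatten bs = mu, all (fun b => b != [::]) bs,
      all (fun b => hookM b == k) (take (size bs).-1 bs)
    & (hookM (last [::] bs) <= k)%N].
Proof.
elim: fuel mu => [|fuel IH] [|x mu] // le_mu pmu /= le_xk.
have [n nE] : exists n, (k.+1 - x)%N = n.+1 by exists (k - x)%N; rewrite subSn.
rewrite nE; set nu := drop n.+1 (x :: mu).
have le_nu : (size nu <= fuel)%N.
  by rewrite size_drop /= subSS; apply: leq_trans (leq_subr _ _) _.
have [mu_sorted mu0] := andP pmu.
have geq_trans : transitive geq by move=> b a c ba cb; apply: leq_trans cb ba.
have pnu : is_part nu.
  rewrite /is_part (subseq_sorted geq_trans (drop_subseq _ _) mu_sorted).
  by apply: contra mu0; apply: mem_drop.
have nuk : (head 0 nu <= k)%N.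
  case nuE: nu => [|y s] //=; apply: leq_trans le_xk.
  have : y \in x :: mu by apply: (@mem_drop n.+1); rewrite -/nu nuE mem_head.
  rewrite inE => /orP[/eqP->//|].
  by have /allP := order_path_min geq_trans mu_sorted; apply.
have [fl ne hk hl] := IH _ le_nu pnu nuk.
split => /=.
- by rewrite fl cat_take_drop.
- by [].
- case bsE: (ksplit_rec _ _ _) hk => [|b bs] //= hk; rewrite hk andbT.
  have : (n.+1 < size (x :: mu))%N.
    rewrite ltnNge; apply/negP => /drop_oversize nu0.
    by move: bsE; rewrite /nu nu0; case: (fuel).
  move=> lt_n; rewrite /hookM /= size_take; move: lt_n => /= lt_n.
  rewrite ltnS in lt_n; rewrite lt_n addnS /=.
  by apply/eqP/succn_inj; rewrite -addnS -nE subnKC // ltnW.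
case bsE: (ksplit_rec _ _ _) hl => [|b bs] //= _; rewrite /hookM /= addnS /=.
have kE : k = (x + n)%N by apply/succn_inj; rewrite -addnS -nE subnKC // leqW.
by rewrite kE leq_add2l size_take_min geq_minl.
Qed.

Lemma ksplitP (k : nat) (mu : seq nat) : is_part mu -> (head 0 mu <= k)%N ->
  let bs := ksplit k mu in
  [/\ flatten bs = mu, all (fun b => b != [::]) bs,
      all (fun b => hookM b == k) (take (size bs).-1 bs)
    & (hookM (last [::] bs) <= k)%N].
Proof. exact: ksplit_recP. Qed.

(* Main.v *)
(* The operators B_n satisfy one quadratic relation,
     B_i B_j - t B_(i+1) B_(j-1)
       = - (B_(j-1) B_(i+1) - t B_j B_i),
   so that (1 - t e_12) B_i B_j is alternating in the exponents (i, j - 1).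
   Consequently, a product of factors (1 - t e_ab) applied to words in the B_n
   is alternating in two adjacent positions as soon as its set of roots contains
   (i, i+1) and is otherwise symmetric under the exchange of i and i+1.

   Let R be the rectangle with m rows equal to l, and let la be a block with n
   rows and first part j = l + r > l, where m = n + r. Then B_R B_la is the
   product over the roots internal to the m rows of R and to the n rows of la.
   As R is a rectangle, the missing factors joining the last r rows of R to la
   may be added freely: the terms this creates vanish by alternation. The result
   is B_(first n rows) B_(last r rows, la) times the factors joining the first n
   rows of R to its last r rows. With the alternating factors of both groups of
   rows, these form a Vandermonde determinant; its expansion exchanges rows of R
   and la, and yields
     B_R B_la = sum_s c_s B_la' B_R'
   where the exponents of la' and those taken from R in R' partition an interval
   of length m. The exponent of the first row of la equals the top of that
   interval, so it must be used by la' for the term not to vanish: la' has first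
   part j, all its parts are at least l, and R' has first part l. Hence the
   terms are blocks of k-splits, and the theorem follows by induction on the
   number of parts, the case j <= l being the definition of G. *)

Require Import Defs.
From Stdlib Require Import FunctionalExtensionality.
From mathcomp Require Import all_boot all_order all_fingroup all_algebra.
From mathcomp Require Import finmap monalg ring zify.

Set Implicit Arguments.
Unset Strict Implicit.
Unset Printing Implicit Defensive.

Import Order.TTheory GRing.Theory Num.Theory.
Local Open Scope ring_scope.

(** * Skewing and the derivations p_r^perp *)

Section Leibniz.
Variables (F : fieldType) (A : comAlgType F) (d : A -> A).
Hypothesis dD : forall x y, d (x + y) = d x + d y.
Hypothesis dZ : forall c x, d (c *: x) = c *: d x.
Let leibniz x y := d (x * y) = d x * y + x * d y.

(** The elements x satisfying the Leibniz rule against all y form a subalgebra. The rule for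
    $p_r^\perp$ then only has to be checked on the power sums. *)
Lemma leibnizD x1 x2 y : leibniz x1 y -> leibniz x2 y -> leibniz (x1 + x2) y.
Proof. by rewrite /leibniz => e1 e2; rewrite !(mulrDl, dD) e1 e2 addrACA. Qed.

Lemma leibnizZ c x y : leibniz x y -> leibniz (c *: x) y.
Proof. by rewrite /leibniz => e;
  rewrite -!scalerAl !dZ e scalerDr -scalerAl. Qed.

Lemma leibniz1 y : d 1 = 0 -> leibniz 1 y.
Proof. by rewrite /leibniz => ->; rewrite !mul1r mul0r add0r. Qed.

Lemma leibnizM x1 x2 y : (forall z, leibniz x1 z) -> (forall z, leibniz x2 z) ->
  leibniz (x1 * x2) y.
Proof.
rewrite /leibniz => e1 e2.
by rewrite -mulrA !e1 e2 mulrDr mulrDl !mulrA addrA.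
Qed.

End Leibniz.

(* A sealed copy of perp: comparing two instances of perp by unfolding them
   does not terminate in reasonable time. *)
Fact skew_key : unit. Proof. by []. Qed.
Definition skew (F : fieldType) := locked_with skew_key (@perp F).

Lemma skewE (F : fieldType) : @skew F = @perp F.
Proof. by rewrite /skew unlock. Qed.

Section Skew.
Variable F : fieldType.
Hypothesis F0 : [pchar F] =i pred0.
Implicit Types (f g h : Lam F) (m : {cmonom nat}).

Lemma mcoeff_skew f g m : (skew f g)@_m = (zee F m)^-1 * hall g (f * << m >>).
Proof. by rewrite skewE; apply: perpE. Qed.

Lemma hall_skew f g h : hall (skew f g) h = hall g (f * h).
Proof. by rewrite skewE; apply: hall_perp. Qed.

Lemma hallDr f g h : hall f (g + h) = hall f g + hall f h.
Proof.
rewrite /hall -big_split; apply: eq_bigr => m _ /=.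
by rewrite mcoeffD mulrDr.
Qed.

Lemma hallZr c f g : hall f (c *: g) = c * hall f g.
Proof.
rewrite /hall mulr_sumr; apply: eq_bigr => m _ /=.
by rewrite mcoeffZ mulrCA.
Qed.

Lemma skewDl f g h : skew (f + g) h = skew f h + skew g h.
Proof.
apply/malgP => m; rewrite [RHS]mcoeffD !mcoeff_skew (mulrDl f g << m >>).
by rewrite hallDr mulrDr.
Qed.

Lemma skewZl c f h : skew (c *: f) h = c *: skew f h.
Proof.
apply/malgP => m; rewrite [RHS]mcoeffZ !mcoeff_skew -(scalerAl c f << m >>).
by rewrite hallZr mulrCA.
Qed.

Lemma skewDr f g h : skew f (g + h) = skew f g + skew f h.
Proof.
apply/malgP => m; rewrite [RHS]mcoeffD !mcoeff_skew -mulrDr.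
by rewrite !(hallC _ (f * _)) hallDr.
Qed.

Lemma skewZr c f h : skew f (c *: h) = c *: skew f h.
Proof.
apply/malgP => m; rewrite [RHS]mcoeffZ !mcoeff_skew.
by rewrite !(hallC _ (f * _)) hallZr mulrCA.
Qed.

Lemma skew0l f : skew 0 f = 0.
Proof. by have := skewZl 0 0 f; rewrite !scale0r. Qed.

Lemma skew0r f : skew f 0 = 0.
Proof. by have := skewZr 0 f 0; rewrite !scale0r. Qed.

Lemma skew_suml (I : Type) (r : seq I) (P : pred I) (G : I -> Lam F) f :
  skew (\sum_(i <- r | P i) G i) f = \sum_(i <- r | P i) skew (G i) f.
Proof.
apply: (big_morph (fun g => skew g f)); last exact: skew0l.
by move=> g h; apply: skewDl.
Qed.

(** Adjunction reverses products, and [hall_inj] allows the identity to be tested against the Hall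
    form. *)
Lemma skewM f g h : skew (f * g) h = skew g (skew f h).
Proof.
apply: (hall_inj F0) => k; rewrite 3!hall_skew.
by rewrite mulrA.
Qed.

Lemma skew1 f : skew 1 f = f.
Proof. by apply: (hall_inj F0) => k; rewrite hall_skew mul1r. Qed.

Lemma skewC f g h : skew f (skew g h) = skew g (skew f h).
Proof. by rewrite -!skewM mulrC. Qed.

End Skew.

Section Coef.
Variable F : fieldType.
Hypothesis F0 : [pchar F] =i pred0.
Implicit Types (f g h : Lam F) (m : {cmonom nat}).

Lemma zeeEw (d : {fset nat}) m : (finsupp m `<=` d)%fset ->
  zee F m = \prod_(i <- d) (i.+1 ^ m i * (m i)`!)%N%:R.
Proof.
move=> le_md; rewrite /zee (big_fset_incl _ le_md) // => i _.
by rewrite -cmE_eq0 => /eqP->; rewrite expn0 fact0.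
Qed.

Lemma zee_mulU i m : zee F (mmul (ucm i) m) = (i.+1 * (m i).+1)%:R * zee F m.
Proof.
pose d := (i |` finsupp m)%fset.
have di : i \in d by rewrite fset1U1.
rewrite (@zeeEw d) ?(@zeeEw d m) ?fsubsetUr //; last by rewrite mdomD mdomU.
rewrite !(big_fsetD1 i di) /= mulrA; congr (_ * _).
  by rewrite cmM cmUU add1n expnS factS -natrM mulnACA.
rewrite big_seq [RHS]big_seq; apply: eq_bigr => j.
by rewrite !inE => /andP[/negPf ji _]; rewrite cmM cmU eq_sym ji.
Qed.

Lemma weight_ucm i : weight (ucm i) = i.+1.
Proof. by rewrite /weight mdomU big_seq_fset1 cmUU muln1. Qed.

Lemma cmonom_ind (P : {cmonom nat} -> Prop) :
  P mone -> (forall i m, P m -> P (mmul (ucm i) m)) -> forall m, P m.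
Proof.
move=> P1 PM m; move e : (mdeg m) => n.
elim: n m e => [|n IH] m e; first by move/mdeg_eq0I: e => ->.
have [i im] : exists i, i \in finsupp m.
  apply/fset0Pn; apply/negP => /eqP m0; move: e.
  by rewrite mdegE m0 big_seq_fset0.
have mE : m = mmul (ucm i) (divcm m (ucm i)).
  apply/eqP/cmP => j; rewrite cmM divcmE cmU; case: eqP => [<-|_] /=;
    last first.
    by rewrite subn0.
  by rewrite subnKC // lt0n cmE_neq0.
rewrite mE; apply/PM/IH; move: e; rewrite {1}mE mdegM mdegU add1n.
by case.
Qed.

Lemma psumE i : psum F i.+1 = << ucm i >>. Proof. by []. Qed.

Lemma mulU_inj m : injective (mmul m : {cmonom nat} -> _).
Proof.
move=> a b /eqP/cmP e; apply/eqP/cmP => i.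
by have := e i; rewrite !cmM => /addnI.
Qed.

Lemma mcoeffUM f m m' : (<< m >> * f)@_(mmul m m') = f@_m'.
Proof.
rewrite (mcoeffMlw _ msuppU_le (fsubset_refl _)) big_seq_fset1.
transitivity (\sum_(k <- msupp f) f@_k *+ (k == m')).
  apply: eq_bigr => k _; rewrite mcoeffUU mul1r.
  by rewrite (inj_eq (@mulU_inj m)).
case: (boolP (m' \in msupp f)) => [mf|mf].
  rewrite (big_fsetD1 m' mf) /= eqxx big_seq big1 ?addr0 // => k.
  by rewrite !inE => /andP[/negPf-> _].
rewrite (mcoeff_outdom mf) big_seq big1 // => k kf.
by case: eqP => // e; move: mf; rewrite -e kf.
Qed.

(** In power sum coordinates $p_r^\perp$ is $r\,\partial/\partial p_r$. The factor is the ratio of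
    the two values of [zee], computed in [zee_mulU]. *)
Lemma skew_psumE i f m :
  (skew (psum F i.+1) f)@_m = (i.+1 * (m i).+1)%:R * f@_(mmul (ucm i) m).
Proof.
rewrite mcoeff_skew psumE.
have -> : << ucm i >> * << m >> = << mmul (ucm i) m >> :> Lam F.
  by rewrite malgM_def fgmulUU mulr1.
by rewrite hallU zee_mulU (mulrC _%:R) -mulrA mulKf ?zee_neq0.
Qed.

Lemma malgUM m m' : << mmul m m' >> = << m >> * << m' >> :> Lam F.
Proof. by rewrite malgM_def fgmulUU mulr1. Qed.

Lemma mcoeffUM_eq0 f i m : m i = 0%N -> (<< ucm i >> * f)@_m = 0.
Proof.
move=> mi; rewrite (mcoeffMlw _ msuppU_le (fsubset_refl _)) big_seq_fset1.
apply: big1 => k _; case: eqP => // e.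
by move: mi; rewrite -e cmM cmUU.
Qed.

Lemma divUK i m : m i != 0%N -> mmul (ucm i) (divcm m (ucm i)) = m.
Proof.
move=> mi; apply/eqP/cmP => j; rewrite cmM divcmE cmU.
by case: eqP => [<-|_]; rewrite ?subnKC ?lt0n ?subn0.
Qed.

Lemma mcoeffUM_div f i m : m i != 0%N ->
  (<< ucm i >> * f)@_m = f@_(divcm m (ucm i)).
Proof. by move=> mi; rewrite -{1}(divUK mi) mcoeffUM. Qed.

Lemma skew_psum_psum i j :
  skew (psum F i.+1) << ucm j >> = (i.+1 * (i == j))%:R *: 1.
Proof.
apply/malgP => m; rewrite [RHS]mcoeffZ mcoeff1 skew_psumE mcoeffU1.
have [->|m1] := eqVneq m mone.
  rewrite cm1 mulr1 muln1; case: (eqVneq i j) => [->|ij].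
    suff -> : mmul (ucm j) mone = ucm j by rewrite eqxx mulr1 muln1.
    by apply/eqP/cmP => l; rewrite cmM cm1 addn0.
  case: eqP => [/(congr1 (fun m : {cmonom nat} => m j))|_].
    by rewrite cmM cm1 cmUU cmU (negPf ij).
  by rewrite mulr0 muln0.
rewrite mulr0; case: eqP => [e|_]; last by rewrite mulr0.
by have := congr1 (@mdeg nat) e; rewrite mdegM !mdegU; move/eqP;
  rewrite add1n eqSS eq_sym mdeg_eq0 (negPf m1).
Qed.

(** The Leibniz rule on a generator, by coefficients. For $i=j$ the multiplicity m i + 1 splits into
    m i, from differentiating g, and 1, from differentiating the generator. *)
Lemma skew_psumUM i j g : skew (psum F i.+1) (<< ucm j >> * g)
  = skew (psum F i.+1) << ucm j >> * g + << ucm j >> * skew (psum F i.+1) g.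
Proof.
apply/malgP => m; transitivity ((i.+1 * (i == j))%:R * g@_m
              + (<< ucm j >> * skew (psum F i.+1) g)@_m); last first.
  rewrite [RHS]mcoeffD skew_psum_psum; congr (_ + _).
  by rewrite -scalerAl [RHS]mcoeffZ mul1r.
rewrite [LHS]skew_psumE.
have [<-{j}|ij] := eqVneq i j.
  rewrite mcoeffUM muln1; have [mi|mi] := eqVneq (m i) 0%N.
    by rewrite mcoeffUM_eq0 // mi muln1 addr0.
  rewrite (mcoeffUM_div _ mi) skew_psumE divUK // divcmE cmUU subn1 prednK ?lt0n
    //.
  by rewrite mulnS natrD mulrDl.
rewrite muln0 mul0r add0r; have [mj|mj] := eqVneq (m j) 0%N.
  by rewrite !mcoeffUM_eq0 ?mulr0 // cmM cmU (negPf ij) mj.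
rewrite (mcoeffUM_div _ mj) mcoeffUM_div ?cmM ?cmU ?(negPf ij) // skew_psumE.
rewrite divcmE cmU (eq_sym j i) (negPf ij) subn0; congr (_ * g@_ _).
by apply/eqP/cmP => l; rewrite !(divcmE, cmM, cmU);
  case: (eqVneq j l) => [<-|_]; rewrite ?(negPf ij) ?subn0 ?add0n.
Qed.

Lemma malg_ind (P : Lam F -> Prop) :
  (forall f g, P f -> P g -> P (f + g)) -> (forall c f, P f -> P (c *: f)) ->
  (forall m, P << m >>) -> forall f, P f.
Proof.
move=> PD PZ PU f; rewrite (monalgE f); elim/big_ind: _ => //.
  by rewrite -(scale0r << mone >>); apply/PZ/PU.
move=> m _; suff -> : << f@_m *g m >> = f@_m *: << m >> :> Lam F by apply/PZ/PU.
by apply/malgP => m';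
  rewrite [RHS]mcoeffZ [X in _ * X]mcoeffU1 mulr_natr [LHS]mcoeffU.
Qed.

Lemma skew_psumM i f g : skew (psum F i.+1) (f * g)
  = skew (psum F i.+1) f * g + f * skew (psum F i.+1) g.
Proof.
have dD := skewDr (psum F i.+1); have dZ c := skewZr c (psum F i.+1).
elim/malg_ind: f => [f1 f2 IH1 IH2|c f IH|m].
- exact (@leibnizD F (Lam F) _ dD f1 f2 g IH1 IH2).
- exact (@leibnizZ F (Lam F) _ dZ c f g IH).
elim/cmonom_ind: m g => [|j m IH] g.
  have d1 : skew (psum F i.+1) 1 = 0 :> Lam F.
    apply/malgP => m; rewrite skew_psumE mcoeff1 mcoeff0.
    case: eqP => [/(congr1 (@mdeg nat))|_]; last by rewrite mulr0.
    by rewrite mdegM mdegU mdeg1.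
  exact (@leibniz1 F (Lam F) _ g d1).
rewrite malgUM; exact (@leibnizM F (Lam F) _ _ _ g (skew_psumUM i j) IH).
Qed.

(** The monomial in which the variable of index k i receives the exponent a i. Repeated indices
    accumulate, see [monE]. *)
Definition mon (T : Type) (r : seq T) (k a : T -> nat) : {cmonom nat} :=
  \big[mmul/mone]_(i <- r) iter (a i) (mmul (ucm (k i))) mone.

Lemma monE (T : Type) (r : seq T) (k a : T -> nat) j :
  mon r k a j = (\sum_(i <- r | k i == j) a i)%N.
Proof.
rewrite /mon [RHS]big_mkcond /=.
rewrite (big_morph (fun m : {cmonom nat} => m j) (cmM j) (cm1 j)) /=.
apply: eq_bigr => i _; elim: (a i) => [|n IH] /=; first by rewrite cm1 if_same.
by rewrite cmM IH cmU; case: eqP.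
Qed.

Lemma prod_psum (T : Type) (r : seq T) (k a : T -> nat) :
  \prod_(i <- r) psum F (k i).+1 ^+ a i = << mon r k a >>.
Proof.
apply: (big_rec2 (fun (x : Lam F) m => x = << m >>)) => [//|i x m _ ->].
rewrite malgUM; congr (_ * _); elim: (a i) => [|n IH] /=;
  first by rewrite expr0.
by rewrite exprS malgUM IH.
Qed.

End Coef.

(** * Power sum coefficients of h_n and h_n[X(t-1)] *)

Section Complete.
Variable F : fieldType.
Hypothesis F0 : [pchar F] =i pred0.
Implicit Types (f g h : Lam F) (m : {cmonom nat}).

(** Passing from the support of a monomial to an initial segment of the naturals lets different
    monomials share one index range. *)
Lemma big_finsupp (R : Type) (idx : R) (op : Monoid.com_law idx) m n
    (G : nat -> R) :
    (forall i, i \in finsupp m -> (i < n)%N) ->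
    (forall i, m i = 0%N -> G i = idx) ->
  \big[op/idx]_(i <- finsupp m) G i = \big[op/idx]_(i < n) G i.
Proof.
move=> mn G0; rewrite -(big_mkord xpredT G) /index_iota subn0.
transitivity (\big[op/idx]_(i <- [seq i <- iota 0 n | i \in finsupp m]) G i).
  apply/perm_big/uniq_perm; rewrite ?fset_uniq ?filter_uniq ?iota_uniq //.
  by move=> i; rewrite mem_filter mem_iota; case: (boolP (i \in _)) => // /mn->.
rewrite big_filter big_mkcond; apply: eq_bigr => i _.
by case: ifP => // /negbT; rewrite -cmE_eq0 => /eqP /G0.
Qed.

Lemma weight_finsupp m i : i \in finsupp m -> (i < weight m)%N.
Proof.
move=> im; rewrite /weight (big_fsetD1 i im) /=.
apply: leq_trans (leq_addr _ _).
by rewrite leq_pmulr // lt0n cmE_neq0.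
Qed.

Lemma weight_le m i : (m i <= weight m)%N.
Proof.
have [->//|] := eqVneq (m i) 0%N; rewrite cmE_neq0 => im.
by rewrite /weight (big_fsetD1 i im) /= mulSn -addnA leq_addr.
Qed.

Lemma weight1 : weight mone = 0%N.
Proof. by rewrite /weight mdom1 big_nil. Qed.

Lemma weight_mon (T : Type) (r : seq T) (k a : T -> nat) :
  weight (mon r k a) = (\sum_(i <- r) (k i).+1 * a i)%N.
Proof.
rewrite /mon (big_morph weight weightM weight1); apply: eq_bigr => i _.
elim: (a i) => [|n IH] /=; first by rewrite weight1 muln0.
by rewrite weightM IH weight_ucm mulnS.
Qed.

(** Distinct index functions in [hsym] give distinct monomials, so at most one term contributes to a
    given coefficient. *)
Lemma mcoeff_hsym n m :
  (hsym F n)@_m = if weight m == n then (zee F m)^-1 else 0.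
Proof.
pose M (a : {ffun 'I_n -> 'I_n.+1}) : {cmonom nat} :=
  mon (index_enum _) (fun i : 'I_n => nat_of_ord i) (fun i => a i).
have ME (a : {ffun 'I_n -> 'I_n.+1}) (i : 'I_n) : M a i = a i.
  rewrite monE (big_pred1 i) //.
transitivity (\sum_(a : {ffun 'I_n -> 'I_n.+1} |
                (\sum_(i < n) i.+1 * a i)%N == n)
   ((\prod_(i < n) (i.+1 ^ a i * (a i)`!))%N%:R^-1 : F) * (M a == m)%:R).
  rewrite /hsym raddf_sum; apply: eq_bigr => a _.
  by rewrite [LHS]mcoeffZ (@prod_psum F) [X in _ * X]mcoeffU1.
have wM a : weight (M a) = (\sum_(i < n) i.+1 * a i)%N by rewrite weight_mon.
case: eqP => wm; last first.
  apply: big1 => a /eqP wa; case: eqP => [e|_]; last by rewrite mulr0.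
  by case: wm; rewrite -e wM.
(* Multiplicities are bounded by the weight n, so [inord] loses nothing. *)
pose a0 : {ffun 'I_n -> 'I_n.+1} := [ffun i => inord (m (nat_of_ord i))].
have a0E i : a0 i = m i :> nat.
  by rewrite ffunE inordK // ltnS; have := weight_le m i; rewrite wm.
have Ma0 : M a0 = m.
  apply/eqP/cmP => i; have [lt_in|le_ni] := ltnP i n.
    by rewrite (ME a0 (Ordinal lt_in)) a0E.
  rewrite monE big_pred0 => [|j]; last by apply/eqP => e; have := ltn_ord j;
    lia.
  apply/esym/eqP; rewrite cmE_eq0; apply: contraL le_ni => /weight_finsupp.
  by rewrite wm -ltnNge.
rewrite (bigD1 a0) /=; last by rewrite -wM Ma0 wm.
rewrite [X in _ + X]big1 ?addr0 => [|a]; last first.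
  case/andP => _ aa0; case: eqP => [e|_]; last by rewrite mulr0.
  case/eqP: aa0; apply/ffunP => i; apply: val_inj.
  by rewrite /= a0E -e ME.
rewrite Ma0 eqxx mulr1 /zee (@big_finsupp _ _ _ _ n) => [|i /weight_finsupp|i
  ->]; first last.
- by rewrite expn0 fact0.
- by rewrite wm.
by rewrite natr_prod; congr (_^-1); apply: eq_bigr => i _; rewrite a0E.
Qed.

(** The eigenvalue of the substitution $X\mapsto X(t-1)$ on the power sum product of m. *)
Definition plscal (t : F) m : F := \prod_(i <- finsupp m) (t ^+ i.+1 - 1) ^+ m
  i.

Lemma mcoeff_plethXt1 t f m : (plethXt1 t f)@_m = f@_m * plscal t m.
Proof.
have plU (k : {cmonom nat}) : \prod_(i <- finsupp k) ((t ^+ i.+1 - 1) *: psum F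
  i.+1) ^+ k i
    = plscal t k *: << k >> :> Lam F.
  under eq_bigr => i _ do rewrite exprZn.
  rewrite scaler_prod; congr (_ *: _).
  rewrite (@prod_psum F nat _ id (fun i => k i)); congr << _ >>.
  apply/eqP/cmP => j; rewrite monE /=.
  have [jk|jk] := boolP (j \in finsupp k).
    by rewrite -big_filter filter_pred1_uniq ?fset_uniq // big_seq1.
  rewrite big_seq_cond big1; first by apply/esym/eqP; rewrite cmE_eq0.
  by move=> i /andP[ik /eqP e]; move: jk; rewrite -e ik.
transitivity ((\sum_(k <- msupp f) (f@_k * plscal t k) *: << k >> : Lam F)@_m).
  congr (_@_m); apply: eq_bigr => k _; rewrite -scalerA -plU.
  exact: mulr_algl.
rewrite raddf_sum /=.
transitivity (\sum_(k <- msupp f) f@_k * plscal t k * (k == m)%:R).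
  by apply: eq_bigr => k _; rewrite [LHS]mcoeffZ [X in _ * X]mcoeffU1.
case: (boolP (m \in msupp f)) => [mf|mf].
  rewrite (big_fsetD1 m mf) /= eqxx mulr1 big_seq big1 ?addr0 // => k.
  by rewrite !inE => /andP[/negPf-> _]; rewrite mulr0.
rewrite (mcoeff_outdom mf) mul0r big_seq big1 // => k kf.
by case: eqP => [e|_]; rewrite ?mulr0 //; move: mf; rewrite -e kf.
Qed.
End Complete.

(** * The quadratic relation for the B_n *)

Section VertexAlgebra.
Variables (F : fieldType) (t : F) (A : comAlgType F).
Hypothesis F0 : [pchar F] =i pred0.
Implicit Types (x y : A).

(* c_s = h_s[t-1], the coefficients of (1 - y) / (1 - t y). *)
Definition cvtx (s : nat) : F := if s is s'.+1 then (t - 1) * t ^+ s' else 1.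

Lemma sum_cvtx u : \sum_(s < u.+1) cvtx s = t ^+ u.
Proof.
elim: u => [|u IH]; first by rewrite big_ord_recl big_ord0 addr0.
by rewrite big_ord_recr IH /= exprS; ring.
Qed.

(** Newton's identity $u h_u=\sum_r p_r h_{u-r}$ in the alphabet $t-1$, where $p_r=t^r-1$. *)
Lemma cvtx_newton u :
  \sum_(r < u) (t ^+ r.+1 - 1) * cvtx (u - r.+1) = u%:R * cvtx u.
Proof.
case: u => [|u]; first by rewrite big_ord0 mul0r.
rewrite (reindex_inj rev_ord_inj) /=.
transitivity (\sum_(s < u.+1) (t ^+ (u.+1 - s) * cvtx s) - t ^+ u).
  rewrite -sum_cvtx -sumrB; apply: eq_bigr => s _.
  have := ltn_ord s => lt_su.
  have -> : (u.+1 - (u.+1 - s.+1).+1 = s)%N by lia.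
  have -> : (u.+1 - s.+1).+1 = (u.+1 - s)%N by lia.
  by ring.
rewrite big_ord_recl /= mulr1 subn0.
rewrite (eq_bigr (fun=> (t - 1) * t ^+ u)) => [|s _]; last first.
  rewrite /bump add1n mulrCA -exprD; congr (_ * _ ^+ _).
  by have := ltn_ord s; lia.
by rewrite sumr_const card_ord exprS -(mulr_natl _ u) -natr1; ring.
Qed.

Lemma sum_convol (a c : nat -> F) (G : nat -> A) K :
    (forall u, (K <= u)%N -> G u = 0) ->
  \sum_(r < K) \sum_(s < K) (a r * c s) *: G (r + s).+1
    = \sum_(u < K) (\sum_(r < u) a r * c (u - r.+1)%N) *: G u.
Proof.
move=> G0.
transitivity (\sum_(0 <= r < K) \sum_(0 <= u < K | (r < u)%N)
                (a r * c (u - r.+1)%N) *: G u).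
  rewrite big_mkord; apply: eq_bigr => r _.
  transitivity (\sum_(0 + r.+1 <= u < K + r.+1) (a r * c (u - r.+1)%N) *: G u).
    rewrite big_addn addnK big_mkord; apply: eq_bigr => s _.
    by rewrite addnK addnS (addnC r).
  rewrite add0n; case: (ltnP r K) (ltn_ord r) => // lt_rK _.
  rewrite (@big_cat_nat _ _ _ K) /= ?leq_addr //.
  rewrite [X in _ + X]big_nat_cond [X in _ + X]big1 ?addr0 => [|u]; last first.
    by case/andP => /andP[/G0-> _] _; rewrite scaler0.
  by rewrite (big_nat_widenl _ 0).
rewrite (exchange_big_dep_nat xpredT) /= //.
rewrite big_mkord; apply: eq_bigr => u _.
rewrite scaler_suml -[RHS](big_mkord xpredT (fun r => (a r * c (u - r.+1)%N) *:
  G u)).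
by rewrite (big_nat_widen 0 u K) // ltnW.
Qed.

Variables (h : int -> A) (D : int -> A -> A) (d : nat -> A -> A).
Hypothesis DN : forall (i : int) x, i < 0 -> D i x = 0.
Hypothesis D0 : forall x, D 0 x = x.
Hypothesis DD : forall i x y, D i (x + y) = D i x + D i y.
Hypothesis DZ : forall i c x, D i (c *: x) = c *: D i x.
Hypothesis DC : forall i j x, D i (D j x) = D j (D i x).
Hypothesis dD : forall r x y, d r (x + y) = d r x + d r y.
Hypothesis dZ : forall r c x, d r (c *: x) = c *: d r x.
Hypothesis dM : forall r x y, d r (x * y) = d r x * y + x * d r y.
Hypothesis d_h : forall r k, d r (h k) = h (k - r.+1%:Z).
Hypothesis D_newton : forall (i : nat) x,
  i%:R *: D i x = \sum_(r < i) (t ^+ r.+1 - 1) *: d r (D (i%:Z - r.+1%:Z) x).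

Lemma Dx0 i : D i 0 = 0.
Proof. by have := DZ i 0 0; rewrite !scale0r. Qed.

Lemma dx0 r : d r 0 = 0.
Proof. by have := dZ r 0 0; rewrite !scale0r. Qed.

Lemma D_sum i (I : Type) (r : seq I) (P : pred I) (G : I -> A) :
  D i (\sum_(j <- r | P j) G j) = \sum_(j <- r | P j) D i (G j).
Proof. exact: (big_morph _ (DD i) (Dx0 i)). Qed.

Lemma d_sum i (I : Type) (r : seq I) (P : pred I) (G : I -> A) :
  d i (\sum_(j <- r | P j) G j) = \sum_(j <- r | P j) d i (G j).
Proof. exact: (big_morph _ (dD i) (dx0 i)). Qed.

Lemma D_newtonW (i : int) (K : nat) x : i <= K%:Z ->
  i%:~R *: D i x = \sum_(r < K) (t ^+ r.+1 - 1) *: d r (D (i - r.+1%:Z) x).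
Proof.
case: i => [i|i] le_iK; last first.
  rewrite DN // scaler0 big1 // => r _; rewrite DN ?dx0 ?scaler0 //; lia.
rewrite -pmulrn D_newton.
rewrite -(big_mkord xpredT (fun r => (t ^+ r.+1 - 1) *: d r (D (i%:Z - r.+1%:Z)
  x))).
rewrite -(big_mkord xpredT (fun r => (t ^+ r.+1 - 1) *: d r (D (i%:Z - r.+1%:Z)
  x))).
rewrite [RHS](@big_cat_nat _ _ _ i) //= big_nat_cond.
rewrite -big_nat_cond [X in _ = _ + X]big_nat_cond [X in _ = _ + X]big1 ?addr0
  // => r.
by move=> ir; rewrite DN ?dx0 ?scaler0 //; lia.
Qed.

(** Here [h], [D] and [d] abstract $h_k$, $h_i[X(t-1)]^\perp$ and $p_{r+1}^\perp$. In generating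
    functions this says $D(z)h(w)=\frac{1-zw}{1-tzw}h(w)D(z)$. The proof is by induction on i
    through Newton's identity for [D]. *)
Lemma D_hM_expand (K : nat) (i k : int) x : i < K%:Z ->
  D i (h k * x) = \sum_(s < K) cvtx s *: (h (k - s%:Z) * D (i - s%:Z) x).
Proof.
case: i => [i|i] lt_iK; last first.
  by rewrite DN // big1 // => s _; rewrite DN ?mulr0 ?scaler0 //; lia.
elim/ltn_ind: i lt_iK => i IH lt_iK.
have IHz (r : nat) : D (i%:Z - r.+1%:Z) (h k * x)
    = \sum_(s < K) cvtx s *: (h (k - s%:Z) * D (i%:Z - r.+1%:Z - s%:Z) x).
  have [lt_ri|le_ir] := ltnP r i; last first.
    rewrite DN; last lia.
    by rewrite big1 // => s _; rewrite DN ?mulr0 ?scaler0 //; lia.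
  have -> : i%:Z - r.+1%:Z = (i - r.+1)%N by lia.
  by rewrite IH //; lia.
have [->|i_gt0] := posnP i.
  case: K {IH IHz} lt_iK => [|K] _ //;
    rewrite big_ord_recl /= scale1r !subr0 !D0.
  by rewrite big1 ?addr0 // => s _; rewrite DN ?mulr0 ?scaler0 // /bump; lia.
pose G (u : nat) := h (k - u%:Z) * D (i%:Z - u%:Z) x.
have inz : (i%:R : F) != 0 by move/pcharf0P: F0 => ->; rewrite -lt0n.
(* Newton's identity gives i times [D i], and i is invertible in characteristic 0. *)
apply: (scalerI inz); rewrite pmulrn (@D_newtonW _ K) ?ltW //.
transitivity (\sum_(r < K) \sum_(s < K) ((t ^+ r.+1 - 1) * cvtx s) *: G (r +
  s).+1
  + \sum_(s < K) \sum_(r < K) ((t ^+ r.+1 - 1) * cvtx s) *: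
      (h (k - s%:Z) * d r (D (i%:Z - s%:Z - r.+1%:Z) x))).
  rewrite [X in _ = _ + X]exchange_big -big_split; apply: eq_bigr => r _.
  rewrite IHz d_sum scaler_sumr -big_split; apply: eq_bigr => s _ /=.
  rewrite dZ dM d_h scalerA -scalerDr; congr (_ *: (_ * _ + _ * d _ (D _ _)));
    try lia.
    by congr h; lia.
  by congr D; lia.
(* The terms in which [d r] hits the factor [h] form a convolution and contribute s times [cvtx s].
   The others regroup by Newton's identity and contribute i - s times [cvtx s]. *)
rewrite (@sum_convol (fun r => t ^+ r.+1 - 1) cvtx G K); last first.
  by move=> u le_Ku; rewrite /G DN ?mulr0 //; lia.
rewrite scaler_sumr -big_split; apply: eq_bigr => s _ /=.
rewrite cvtx_newton.
transitivity ((s%:R * cvtx s) *: G s + (i%:Z - s%:Z)%:~R * cvtx s *: G s).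
  congr (_ + _); rewrite mulrC -scalerA /G scalerAr (@D_newtonW _ K); last lia.
  rewrite mulr_sumr scaler_sumr; apply: eq_bigr => r _.
  by rewrite -scalerAr scalerA mulrC.
rewrite -scalerDl -mulrDl scalerA -pmulrn; congr ((_ * _) *: _).
by rewrite rmorphB /= !pmulrn; ring.
Qed.

(** The previous expansion multiplied by its denominator $1-tzw$, which leaves only the two terms of
    $1-zw$. *)
Lemma D_hM (i k : int) x :
  D i (h k * x) - t *: D (i - 1) (h (k - 1) * x)
    = h k * D i x - h (k - 1) * D (i - 1) x.
Proof.
have [K lt_iK] : exists K : nat, i < K%:Z by exists `|i|.+1%N; lia.
rewrite (@D_hM_expand K.+1) ?(@D_hM_expand K) //; try lia.
rewrite big_ord_recl /= !subr0 scale1r -addrA; congr (_ + _).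
rewrite scaler_sumr -sumrB.
case: K lt_iK => [|K] lt_iK.
  by rewrite big_ord0 (DN _ (_ : i - 1 < 0)) ?mulr0 ?oppr0 //; lia.
rewrite big_ord_recl big1 => [|s _].
  rewrite /bump /= expr0 mulr1 !subr0 addr0 scale1r -scalerBl.
  have -> : t - 1 - t = -1 by ring.
  by rewrite scaleN1r.
rewrite /bump /= scalerA !add1n exprS.
have -> : k - 1 - s.+1%:Z = k - s.+2%:Z by lia.
have -> : i - 1 - s.+1%:Z = i - s.+2%:Z by lia.
by rewrite mulrCA subrr.
Qed.

Variables (B : int -> A -> A) (bnd : A -> nat).
Hypothesis D_bnd : forall (i : nat) x, (bnd x < i)%N -> D i x = 0.
Hypothesis BE : forall (n : int) x,
  B n x = \sum_(i < (bnd x).+1) h (i%:Z + n) * D i x.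

(** The natural bound of the sum depends on x; larger cutoffs allow several such sums to be
    compared. *)
Lemma B_trunc (n : int) (K : nat) x : (bnd x < K)%N ->
  B n x = \sum_(i < K) h (i%:Z + n) * D i x.
Proof.
move=> lt_K; rewrite BE -(big_mkord xpredT (fun i => h (i%:Z + n) * D i%:Z x)).
rewrite -[RHS](big_mkord xpredT (fun i => h (i%:Z + n) * D i%:Z x)).
rewrite [RHS](@big_cat_nat _ _ _ (bnd x).+1) //=.
rewrite [X in _ = _ + X]big_nat_cond [X in _ = _ + X]big1 ?addr0 // => i.
by case/andP => /andP[? _] _; rewrite D_bnd ?mulr0.
Qed.

(** The truncated normally ordered product of two operators: both multiplications stand to the left
    of both [D]. It is symmetric in a and b because the [D] commute. *)
Let E (K : nat) (a b : int) x :=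
  \sum_(i < K) \sum_(j < K) h (i%:Z + a) * (h (j%:Z + b) * D i (D j x)).

Lemma E_sym K a b x : E K a b x = E K b a x.
Proof.
rewrite /E exchange_big; apply: eq_bigr => i _; apply: eq_bigr => j _.
by rewrite DC mulrCA.
Qed.

Lemma B_comp (a b : int) x : exists K0, forall K, (K0 <= K)%N ->
  B a (B b x) - t *: B (a + 1) (B (b - 1) x) = E K a b x - E K (a + 1) (b - 1)
    x.
Proof.
(* Beyond this bound all truncations used are exact, and [D K] kills every [D j x]. *)
exists (bnd x + \sum_(j < (bnd x).+1) bnd (D j x) + bnd (B b x)
        + bnd (B (b - 1) x)).+1 => K le_K.
have DK (j : nat) : D K (D j x) = 0.
  have [lt_j|le_j] := ltnP (bnd x) j; first by rewrite (D_bnd lt_j) Dx0.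
  apply: D_bnd; apply: leq_trans le_K; rewrite ltnS -!addnA addnCA.
  by rewrite (bigD1 (Ordinal (le_j : j < (bnd x).+1)%N)) //= -addnA leq_addr.
have lt_x : (bnd x < K)%N by apply: leq_trans le_K;
  rewrite ltnS -!addnA leq_addr.
have lt_1 : (bnd (B b x) < K)%N by apply: leq_trans le_K; rewrite ltnS; lia.
have lt_2 : (bnd (B (b - 1) x) < K)%N.
  by apply: leq_trans le_K; rewrite ltnS leq_addl.
(* The first sum gets one term more than the second: its term i + 1 is paired with the term i of the
   second through [D_hM]. The unpaired term 0 needs no reordering, and the surplus top term vanishes
   by [DK]. *)
rewrite (B_trunc a (leqW lt_1)) (B_trunc (a + 1) lt_2) (B_trunc b lt_x).
rewrite (B_trunc (b - 1) lt_x).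
rewrite big_ord_recl D0 scaler_sumr -addrA -sumrB.
transitivity (\sum_(i < K.+1) \sum_(j < K)
     h (i%:Z + a) * (h (j%:Z + b) * D i (D j x)) - E K (a + 1) (b - 1) x).
  rewrite big_ord_recl -addrA; congr (_ + _).
    by rewrite mulr_sumr; apply: eq_bigr => j _; rewrite D0.
  rewrite /E -sumrB; apply: eq_bigr => i _.
  have -> : lift ord0 i = i%:Z + 1 :> int by rewrite /= /bump; lia.
  have -> : i%:Z + 1 + a = i%:Z + (a + 1) by lia.
  rewrite scalerAr -mulrBr !D_sum scaler_sumr -!sumrB mulr_sumr.
  apply: eq_bigr => j _; rewrite -mulrBr; congr (_ * _).
  have := D_hM (i%:Z + 1) (j%:Z + b) (D j x).
  by rewrite addrK -addrA => ->.
congr (_ - _); rewrite big_ord_recr /= [X in _ + X]big1 ?addr0 // => j _.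
by rewrite DK !mulr0.
Qed.

(** By the symmetry of [E], the right-hand side of [B_comp] changes sign under
    $(a,b)\mapsto(b-1,a+1)$. *)
Lemma B_quad (a b : int) x :
  B a (B b x) - t *: B (a + 1) (B (b - 1) x)
    = - (B (b - 1) (B (a + 1) x) - t *: B b (B a x)).
Proof.
have [K1 e1] := B_comp a b x; have [K2 e2] := B_comp (b - 1) (a + 1) x.
move: e2; rewrite subrK addrK => e2.
rewrite (e1 (K1 + K2)%N) ?leq_addr // (e2 (K1 + K2)%N) ?leq_addl //.
by rewrite (E_sym _ b) (E_sym _ (b - 1)) opprB.
Qed.

Lemma BD n x y : B n (x + y) = B n x + B n y.
Proof.
pose K := (bnd x + bnd y + bnd (x + y)).+1.
rewrite (@B_trunc n K) ?(@B_trunc n K x) ?(@B_trunc n K y) /K; try lia.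
by rewrite -big_split; apply: eq_bigr => i _; rewrite DD mulrDr.
Qed.

Lemma BZ n c x : B n (c *: x) = c *: B n x.
Proof.
pose K := (bnd x + bnd (c *: x)).+1.
rewrite (@B_trunc n K) ?(@B_trunc n K x) /K; try lia.
by rewrite scaler_sumr; apply: eq_bigr => i _; rewrite DZ scalerAr.
Qed.

End VertexAlgebra.

(** * The quadratic relation on symmetric functions *)

Section Vertex.
Variables (F : fieldType) (t : F).
Hypothesis F0 : [pchar F] =i pred0.
Implicit Types (f g : Lam F) (m : {cmonom nat}).

Lemma weight_eq0 m : (weight m == 0%N) = (m == mone).
Proof.
apply/eqP/eqP => [w0|->]; last exact: weight1.
apply/eqP/cmP => i; rewrite cm1; have := weight_le m i; rewrite w0; lia.
Qed.

Lemma hsym0 : hsym F 0 = 1.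
Proof.
apply/malgP => m; rewrite mcoeff_hsym mcoeff1 weight_eq0.
by case: eqP => // ->; rewrite /zee mdom1 big_nil invr1.
Qed.

Lemma plethXt1_1 : plethXt1 t 1 = 1.
Proof.
apply/malgP => m; rewrite mcoeff_plethXt1 mcoeff1.
by case: eqP => [->|]; rewrite ?mul0r // /plscal mdom1 big_nil mulr1.
Qed.

Lemma plscalUM i m : plscal t (mmul (ucm i) m) = (t ^+ i.+1 - 1) * plscal t m.
Proof.
pose n := (i + weight m).+1.
rewrite /plscal !(@big_finsupp _ _ _ _ n).
- have lt_in : (i < n)%N by rewrite ltnS leq_addr.
  rewrite [LHS](bigD1 (Ordinal lt_in)) // [X in _ = _ * X](bigD1 (Ordinal
    lt_in)) //=.
  rewrite mulrA cmM cmUU add1n exprS.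
  congr (_ * _); apply: eq_bigr => j; rewrite -val_eqE /= => /negPf ji.
  by rewrite cmM cmU eq_sym ji.
- by move=> j /weight_finsupp lt_j;
  rewrite ltnS (leq_trans (ltnW lt_j)) // leq_addl.
- by move=> j ->; rewrite expr0.
- rewrite mdomD mdomU => j;
  rewrite !inE ltnS => /orP[/eqP->|/weight_finsupp lt_j].
    exact: leq_addr.
  by rewrite (leq_trans (ltnW lt_j)) // leq_addl.
- by move=> j ->; rewrite expr0.
Qed.

Definition qsym n : Lam F := plethXt1 t (hsym F n).

Lemma mcoeff_qsym n m :
  (qsym n)@_m = if weight m == n then plscal t m / zee F m else 0.
Proof.
rewrite mcoeff_plethXt1 mcoeff_hsym.
by case: eqP; rewrite ?mul0r // mulrC.
Qed.

(** At the monomial m, the summand r contributes (r + 1) times m r copies of the coefficient of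
    [qsym n]. These multiplicities add up to the weight of m, which is n. *)
Lemma qsym_newton n :
  n%:R *: qsym n = \sum_(r < n) (t ^+ r.+1 - 1) *: (psum F r.+1 * qsym (n -
    r.+1)).
Proof.
apply/malgP => m; rewrite [RHS]raddf_sum [LHS]mcoeffZ mcoeff_qsym /=.
transitivity (\sum_(r < n)
    if weight m == n then (r.+1 * m r)%:R * (plscal t m / zee F m) else 0).
  case: eqP => [wm|_]; last by rewrite mulr0 big1.
  rewrite -mulr_suml -natr_sum; congr (_%:R * _); rewrite -{1}wm /weight.
  by rewrite (@big_finsupp _ _ _ m n) // => i; [rewrite -wm;
    apply: weight_finsupp | move=> ->; rewrite muln0].
apply: eq_bigr => r _; rewrite [RHS]mcoeffZ psumE.
have [mr|mr] := eqVneq (m r) 0%N.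
  by rewrite mcoeffUM_eq0 // mr muln0 mul0r mulr0 if_same.
rewrite mcoeffUM_div // mcoeff_qsym -{1 3 4}(divUK mr) weightM weight_ucm.
set m' := divcm m (ucm (nat_of_ord r)); rewrite plscalUM zee_mulU //.
have -> : (r.+1 + weight m' == n)%N = (weight m' == n - r.+1)%N.
  by have := ltn_ord r; lia.
case: eqP => _; last by rewrite mulr0.
have -> : m r = (m' r).+1 by rewrite divcmE cmUU subn1 prednK // lt0n.
have nz : (r.+1 * (m' r).+1)%:R != 0 :> F by move/pcharf0P: F0 => ->.
move: nz (zee_neq0 m' F0); move: (_%:R) (zee F m') (plscal t m') => N z p nz z0.
by field; rewrite nz z0.
Qed.

Definition Dop (i : int) f : Lam F := if i is Posz n then skew (qsym n) f else
  0.

Lemma Dop_newton (i : nat) f :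
  i%:R *: Dop i f
    = \sum_(r < i) (t ^+ r.+1 - 1) *: skew (psum F r.+1) (Dop (i%:Z - r.+1%:Z)
      f).
Proof.
rewrite /= -skewZl qsym_newton skew_suml; apply: eq_bigr => r _.
have -> : i%:Z - r.+1%:Z = (i - r.+1)%N by have := ltn_ord r; lia.
rewrite [LHS]skewZl; congr (_ *: _).
by transitivity (skew (qsym (i - r.+1)) (skew (psum F r.+1) f));
  [apply: skewM | apply: skewC].
Qed.

Lemma skew_psum_hsymz r (k : int) :
  skew (psum F r.+1) (hsymz F k) = hsymz F (k - r.+1%:Z).
Proof.
case: k => [k|k]; last first.
  rewrite skew0r; have -> : Negz k - r.+1%:Z = Negz (k + r.+1) by lia.
  by [].
apply/malgP => m; rewrite skew_psumE // mcoeff_hsym weightM weight_ucm zee_mulU.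
have [lt_kr|le_rk] := ltnP k r.+1.
  have -> : k%:Z - r.+1%:Z = Negz (r - k) by lia.
  by rewrite mcoeff0; case: eqP => [?|_]; [lia | rewrite mulr0].
have -> : k%:Z - r.+1%:Z = (k - r.+1)%N by lia.
rewrite [RHS]mcoeff_hsym.
have -> : (r.+1 + weight m == k)%N = (weight m == k - r.+1)%N by lia.
case: eqP => _; last by rewrite mulr0.
have nz : (r.+1 * (m r).+1)%:R != 0 :> F by move/pcharf0P: F0 => ->.
by rewrite invfM mulVKf.
Qed.

Lemma Dop_gt (i : nat) f : (degL f < i)%N -> Dop i f = 0.
Proof. by move=> lt_fi; rewrite /= skewE; apply: perp_hsym_gt. Qed.

Lemma DopN (i : int) f : i < 0 -> Dop i f = 0.
Proof. by case: i. Qed.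

Lemma Dop0 f : Dop 0 f = f.
Proof. by rewrite /= /qsym hsym0 plethXt1_1 skew1. Qed.

Lemma DopD i f g : Dop i (f + g) = Dop i f + Dop i g.
Proof. by case: i => [i|i] /=; [apply: skewDr | rewrite addr0]. Qed.

Lemma DopZ i c f : Dop i (c *: f) = c *: Dop i f.
Proof. by case: i => [i|i] /=; [apply: skewZr | rewrite scaler0]. Qed.

Lemma DopC i j f : Dop i (Dop j f) = Dop j (Dop i f).
Proof.
case: i j => [i|i] [j|j].
- exact: skewC.
- exact: skew0r.
- exact/esym/skew0r.
- by [].
Qed.

Lemma BopE (n : int) f :
  Bop t n f = \sum_(i < (degL f).+1) hsymz F (i%:Z + n) * Dop i f.
Proof. by rewrite /Bop; apply: eq_bigr => i _; rewrite /= skewE. Qed.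

Lemma Bop_quad (a b : int) f :
  Bop t a (Bop t b f) - t *: Bop t (a + 1) (Bop t (b - 1) f)
    = - (Bop t (b - 1) (Bop t (a + 1) f) - t *: Bop t b (Bop t a f)).
Proof.
apply: (@B_quad F t (Lam F) F0 (hsymz F) Dop (fun r => skew (psum F r.+1))
          DopN Dop0 DopD DopZ DopC _ _ _ skew_psum_hsymz Dop_newton
          (Bop t) (@degL F) Dop_gt BopE).
- by move=> r x y; apply: skewDr.
- by move=> r c x; apply: skewZr.
- by move=> r x y; apply: skew_psumM.
Qed.

Lemma BopD n f g : Bop t n (f + g) = Bop t n f + Bop t n g.
Proof. exact: (@BD F (Lam F) (hsymz F) Dop DopD (Bop t) (@degL F) Dop_gt BopE).
  Qed.

Lemma BopZ n c f : Bop t n (c *: f) = c *: Bop t n f.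
Proof. exact: (@BZ F (Lam F) (hsymz F) Dop DopZ (Bop t) (@degL F) Dop_gt BopE).
  Qed.

(** These values on the constant 1 make it possible to append zero parts to the last block of a
    k-split. *)
Lemma Bop_1 (n : int) : n <= 0 -> Bop t n 1 = (n == 0)%:R.
Proof.
have d1 : degL (1 : Lam F) = 0%N.
  apply/eqP; rewrite -leqn0; apply/bigmax_leqP_seq => m m1 _.
  by rewrite (homog1 m1).
move=> n_le0; rewrite BopE d1 big_ord_recl big_ord0 addr0 Dop0 mulr1 add0r.
by case: n n_le0 => [[|n]|n] //= _; rewrite hsym0.
Qed.

End Vertex.

(** * Raising operators *)

Definition shift (ab : nat * nat) (g : nat -> int) : nat -> int :=
  fun c => g c + (c == ab.1)%:R - (c == ab.2)%:R.

Definition nswap (i j c : nat) : nat :=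
  if c == i then j else if c == j then i else c.

Definition pswap (i j : nat) (ab : nat * nat) : nat * nat :=
  (nswap i j ab.1, nswap i j ab.2).

Lemma nswapK i j : involutive (nswap i j).
Proof. by move=> c; rewrite /nswap; do !case: eqP; lia. Qed.

Lemma pswapK i j : involutive (pswap i j).
Proof. by case=> a b; rewrite /pswap /= !nswapK. Qed.

Lemma shiftC ab cd g : shift ab (shift cd g) = shift cd (shift ab g).
Proof. by apply: functional_extensionality => c; rewrite /shift; lia. Qed.

Lemma shift_nswap i j ab g :
  shift (pswap i j ab) (g \o nswap i j) = shift ab g \o nswap i j.
Proof.
apply: functional_extensionality => c; rewrite /shift /=.
by rewrite -!(inj_eq (inv_inj (nswapK i j)) c) !nswapK.
Qed.

Section Raising.
Variables (F : fieldType) (t : F) (V : lmodType F).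
Implicit Types (Phi Psi : (nat -> int) -> V) (g : nat -> int)
  (l : seq (nat * nat)).

Definition rop1 ab Psi : (nat -> int) -> V :=
  fun g => Psi g - t *: Psi (shift ab g).

Definition rop Phi l : (nat -> int) -> V := foldr rop1 Phi l.

Lemma rop1C ab cd Psi : rop1 ab (rop1 cd Psi) = rop1 cd (rop1 ab Psi).
Proof.
apply: functional_extensionality => g; rewrite /rop1 shiftC !scalerBr !opprB.
by rewrite -!addrA; congr (_ + _); rewrite addrCA [RHS]addrCA [- _ - _]addrC.
Qed.

Lemma rop_cat Phi l1 l2 : rop Phi (l1 ++ l2) = rop (rop Phi l2) l1.
Proof. exact: foldr_cat. Qed.

Lemma rop_rop1 Phi ab l : rop (rop1 ab Phi) l = rop1 ab (rop Phi l).
Proof. by elim: l => //= cd l ->; rewrite rop1C. Qed.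

Lemma ropC Phi l1 l2 : rop (rop Phi l2) l1 = rop (rop Phi l1) l2.
Proof. by elim: l2 => //= ab l2 IH; rewrite rop_rop1 IH. Qed.

Lemma rop_perm Phi l1 l2 : perm_eq l1 l2 -> rop Phi l1 = rop Phi l2.
Proof.
move=> l12; apply/esym; pose P l := rop Phi l = rop Phi l1.
apply: (@catCA_perm_ind _ P _ _ _ l12) => // s1 s2 s3; rewrite /P => <-.
by rewrite !rop_cat ropC.
Qed.

Definition alt i j Psi := forall g, Psi (g \o nswap i j) = - Psi g.

Lemma rop_alt_map i j l Psi g : alt i j Psi ->
  rop Psi (map (pswap i j) l) (g \o nswap i j) = - rop Psi l g.
Proof.
move=> aPsi; elim: l g => [|ab l IH] g /=; first exact: aPsi.
by rewrite /rop1 shift_nswap !IH scalerN opprB opprK addrC.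
Qed.

(** The exchange carries the factor of each root to that of the exchanged root, and the order of the
    factors is immaterial. *)
Lemma rop_alt i j l Psi : alt i j Psi -> perm_eq (map (pswap i j) l) l ->
  alt i j (rop Psi l).
Proof. by move=> aPsi pl g;
  rewrite -(rop_alt_map _ _ aPsi) (rop_perm _ pl). Qed.

(** The transposition of i and k is that of i and j conjugated by that of j and k: three sign
    changes. *)
Lemma alt_trans i j k Psi : i != j -> i != k -> j != k ->
  alt i j Psi -> alt j k Psi -> alt i k Psi.
Proof.
move=> ij ik jk aij ajk g.
have -> : g \o nswap i k = ((g \o nswap j k) \o nswap i j) \o nswap j k.
  apply: functional_extensionality => c /=; congr g.
  by rewrite /nswap; do !case: eqP; lia.
by rewrite ajk aij ajk opprK.
Qed.

Lemma alt_range lo hi Psi :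
    (forall i, (lo <= i)%N -> (i.+1 < hi)%N -> alt i i.+1 Psi) ->
  forall i j, (lo <= i < j)%N -> (j < hi)%N -> alt i j Psi.
Proof.
move=> aPsi i j; elim: j => [|j IH] //; first by rewrite ltn0 andbF.
case/andP => lo_i; rewrite ltnS leq_eqVlt => /orP[/eqP<-|lt_ij] lt_j;
  first exact: aPsi.
apply: (@alt_trans i j j.+1); rewrite ?neq_ltn ?lt_ij ?ltnSn ?leqW //.
  by apply: IH; rewrite ?lo_i ?lt_ij // ltnW.
by apply: aPsi => //; rewrite (leq_trans lo_i) // ltnW.
Qed.

Lemma alt_eq0 i j Psi g : [pchar F] =i pred0 -> alt i j Psi -> g i = g j ->
  Psi g = 0.
Proof.
move=> F0 aPsi gij; have := aPsi g.
have -> : g \o nswap i j = g.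
  apply: functional_extensionality => c /=; rewrite /nswap.
  by case: eqP => [->//|_]; case: eqP => [->|].
move/eqP; rewrite -addr_eq0 -mulr2n -scaler_nat scaler_eq0.
by move/pcharf0P: F0 => -> /= /eqP.
Qed.

(* Root sets are given as relations, restricted to the indices below N. *)
Definition rts (N : nat) (P : rel nat) : seq (nat * nat) :=
  [seq ab <- [seq (a, b) | a <- iota 0 N, b <- iota 0 N] | P ab.1 ab.2].

Lemma rts_uniq N P : uniq (rts N P).
Proof.
apply/filter_uniq/allpairs_uniq; rewrite ?iota_uniq //.
by move=> [a b] [c d] _ _ /= [-> ->].
Qed.

Lemma mem_rts N P a b : ((a, b) \in rts N P) = [&& (a < N)%N, (b < N)%N & P a
  b].
Proof.
rewrite mem_filter /= andbA andbC; congr (_ && _).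
apply/allpairsP/andP => [[[c d] [/= + + [-> ->]]]|[aN bN]].
  by rewrite !mem_iota !add0n.
by exists (a, b); rewrite /= !mem_iota.
Qed.

Lemma eq_rts N P Q : (forall a b, (a < N)%N -> (b < N)%N -> P a b = Q a b) ->
  perm_eq (rts N P) (rts N Q).
Proof.
move=> PQ; apply: uniq_perm; rewrite ?rts_uniq // => -[a b].
by rewrite !mem_rts; case: ltnP => // aN; case: ltnP => // bN; rewrite PQ.
Qed.

Lemma rop_rts_add N P Q c d Phi g : (c < N)%N -> (d < N)%N -> P c d = false ->
    (forall a b, (a < N)%N -> (b < N)%N -> Q a b = P a b || ((a, b) == (c, d)))
      ->
  rop Phi (rts N Q) g
    = rop Phi (rts N P) g - t *: rop Phi (rts N P) (shift (c, d) g).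
Proof.
move=> cN dN Pcd QP.
suff /(rop_perm Phi)-> : perm_eq (rts N Q) ((c, d) :: rts N P) by [].
apply: uniq_perm; rewrite /= ?rts_uniq ?mem_rts ?Pcd ?andbF // => -[a b].
rewrite inE !mem_rts; case: ltnP => [aN|Na]; last first.
  by rewrite orbF; apply/esym/eqP => -[ac _]; move: Na; rewrite ac leqNgt cN.
case: ltnP => [bN|Nb]; last first.
  by rewrite orbF; apply/esym/eqP => -[_ bd]; move: Nb; rewrite bd leqNgt dN.
by rewrite QP // orbC.
Qed.

Lemma rop_rts_alt N P i j Psi : alt i j Psi -> (i < N)%N -> (j < N)%N ->
    (forall a b, (a < N)%N -> (b < N)%N -> P (nswap i j a) (nswap i j b) = P a
      b) ->
  alt i j (rop Psi (rts N P)).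
Proof.
move=> aPsi iN jN PP; apply: rop_alt => //; apply: uniq_perm.
- by rewrite map_inj_uniq ?rts_uniq //; apply/inv_inj/pswapK.
- exact: rts_uniq.
have swN a : (nswap i j a < N)%N = (a < N)%N.
  by rewrite /nswap; case: eqP => [->|_]; [|case: eqP => [->|//]];
    rewrite iN jN.
move=> [a b]; rewrite -{1}(pswapK i j (a, b)) mem_map;
  last exact/inv_inj/pswapK.
rewrite !mem_rts !swN; case: ltnP => // aN; case: ltnP => // bN.
by rewrite PP.
Qed.

Lemma rts_cat N P Q : (forall a b, (a < N)%N -> (b < N)%N -> ~~ (P a b && Q a
  b)) ->
  perm_eq (rts N (fun a b => P a b || Q a b)) (rts N P ++ rts N Q).
Proof.
move=> PQ; apply: uniq_perm; first exact: rts_uniq.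
  rewrite cat_uniq !rts_uniq andbT /=; apply/hasPn => -[a b].
  rewrite !mem_rts => /and3P[aN bN Qab]; rewrite aN bN /=.
  by have := PQ a b aN bN; rewrite Qab andbT.
move=> [a b]; rewrite mem_cat !mem_rts.
by case: ltnP => // aN; case: ltnP.
Qed.

End Raising.

Lemma rop_eq (F : fieldType) (t : F) (V : lmodType F) N
    (Phi : (nat -> int) -> V) l :
    (forall g g', (forall i, (i < N)%N -> g i = g' i) -> Phi g = Phi g') ->
  forall g g', (forall i, (i < N)%N -> g i = g' i) -> rop t Phi l g = rop t Phi
    l g'.
Proof.
move=> ePhi; elim: l => [|ab l IH] g g' gg' /=; first exact: ePhi.
rewrite /rop1 (IH _ _ gg') (IH (shift ab g) (shift ab g')) // => i /gg'.
by rewrite /shift => ->.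
Qed.

(** * Words in the operators, with a set of raising factors *)

Section Words.
Variables (F : fieldType) (t : F) (V : lmodType F) (b : int -> V -> V).
Hypothesis F0 : [pchar F] =i pred0.
Hypothesis bD : forall n x y, b n (x + y) = b n x + b n y.
Hypothesis bZ : forall n c x, b n (c *: x) = c *: b n x.
Hypothesis b_quad : forall (i j : int) x,
  b i (b j x) - t *: b (i + 1) (b (j - 1) x)
    = - (b (j - 1) (b (i + 1) x) - t *: b j (b i x)).
Implicit Types (x y : V) (g : nat -> int) (s : seq nat).

(* The index of the i-th operator is g i + i: the straightening relations then
   act on g by plain permutations of the positions. *)
Definition word s x g : V := foldr (fun i y => b (g i + i%:Z) y) x s.

Lemma word_eq s x g g' : {in s, g =1 g'} -> word s x g = word s x g'.
Proof.
elim: s => //= i s IH gg'; rewrite gg' ?mem_head // IH // => j js.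
by rewrite gg' // inE js orbT.
Qed.

Lemma wordD s x y g : word s (x + y) g = word s x g + word s y g.
Proof. by elim: s => //= i s ->; rewrite bD. Qed.

Lemma wordZ s c x g : word s (c *: x) g = c *: word s x g.
Proof. by elim: s => //= i s ->; rewrite bZ. Qed.

Lemma wordN s x g : word s (- x) g = - word s x g.
Proof. by rewrite -scaleN1r wordZ scaleN1r. Qed.

Lemma word_cat s1 s2 x g : word (s1 ++ s2) x g = word s1 (word s2 x g) g.
Proof. exact: foldr_cat. Qed.

(** This is [b_quad] for the operators at positions i and i + 1. The position included in each index
    turns the substitution $(i,j)\mapsto(j-1,i+1)$ into a plain exchange. *)
Lemma word_alt i N x : (i.+1 < N)%N ->
  alt i i.+1 (rop1 t (i, i.+1) (word (iota 0 N) x)).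
Proof.
move=> lt_iN g.
have -> : iota 0 N = iota 0 i ++ [:: i, i.+1 & iota i.+2 (N - i.+2)].
  have {1}-> : N = (i + (2 + (N - i.+2)))%N by lia.
  by rewrite iotaD add0n.
pose y := word (iota i.+2 (N - i.+2)) x g.
have E g' : (forall c, c != i -> c != i.+1 -> g' c = g c) ->
    word (iota 0 i ++ [:: i, i.+1 & iota i.+2 (N - i.+2)]) x g'
    = word (iota 0 i) (b (g' i + i%:Z) (b (g' i.+1 + i.+1%:Z) y)) g.
  move=> gg'; rewrite word_cat /=.
  have -> : word (iota i.+2 (N - i.+2)) x g' = y.
    by apply: word_eq => c; rewrite mem_iota => ?; apply: gg'; lia.
  by apply: word_eq => c; rewrite mem_iota => ?; apply: gg'; lia.
have out_sw c : c != i -> c != i.+1 -> (g \o nswap i i.+1) c = g c.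
  by move=> ci cj; rewrite /= /nswap (negPf ci) (negPf cj).
have out_sh h c : c != i -> c != i.+1 -> shift (i, i.+1) h c = h c.
  by move=> ci cj; rewrite /shift /= (negPf ci) (negPf cj) addr0 subr0.
have out_ss c : c != i -> c != i.+1 ->
    shift (i, i.+1) (g \o nswap i i.+1) c = g c.
  by move=> ci cj; rewrite out_sh ?out_sw.
rewrite /rop1 (E _ out_sw) (E _ out_ss) (E _ (out_sh g)) (E g) //.
rewrite -!wordZ -!wordN -!wordD -wordN; congr (word _ _ g).
have si : (i.+1 == i) = false by lia.
have is1 : (i == i.+1) = false by lia.
rewrite /shift /nswap /= !eqxx si is1 /= ?mulr0n ?addr0 ?subr0.
have := b_quad (g i + i%:Z) (g i.+1 + i.+1%:Z) y.
have -> : g i.+1 + i.+1%:Z - 1 = g i.+1 + i%:Z by lia.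
have -> : g i + i%:Z + 1 = g i + i.+1%:Z by lia.
have -> : g i.+1 + 1%:R + i%:Z = g i.+1 + i.+1%:Z by lia.
have -> : g i - 1%:R + i.+1%:Z = g i + i%:Z by lia.
have -> : g i + 1%:R + i%:Z = g i + i.+1%:Z by lia.
have -> : g i.+1 - 1%:R + i.+1%:Z = g i.+1 + i%:Z by lia.
by move=> ->; rewrite opprK.
Qed.

(* Each root in P contributes a factor 1 - t e_cd. In a product B_mu B_nu the roots
   joining the rows of mu to those of nu are absent, see BB_cat. *)
Definition HL N (P : rel nat) x : (nat -> int) -> V :=
  rop t (word (iota 0 N) x) (rts N P).

Lemma HL_eq N (P : rel nat) x g g' : (forall i, (i < N)%N -> g i = g' i) ->
  HL N P x g = HL N P x g'.
Proof.
apply: rop_eq => h h' hh'; apply: word_eq => i.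
by rewrite mem_iota add0n; apply: hh'.
Qed.

(** The factor of the root (i, i+1) is applied to the word first, where [word_alt] applies. The
    remaining roots are stable under the exchange and preserve the alternation. *)
Lemma HL_alt N (P : rel nat) x i : (i.+1 < N)%N -> P i i.+1 -> P i.+1 i = false
  ->
    (forall c d, (c < N)%N -> (d < N)%N -> (c, d) != (i, i.+1) ->
       (c, d) != (i.+1, i) -> P (nswap i i.+1 c) (nswap i i.+1 d) = P c d) ->
  alt i i.+1 (HL N P x).
Proof.
move=> lt_iN Pi PiN Psw.
pose P0 c d := P c d && ((c, d) != (i, i.+1)).
pose P1 (c d : nat) := (c, d) == (i, i.+1).
have i1N : (i < N)%N by apply: ltnW.
suff -> : HL N P x = rop t (rop1 t (i, i.+1) (word (iota 0 N) x)) (rts N P0).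
  apply: rop_rts_alt => //; first exact: word_alt.
  move=> c d cN dN; rewrite /P0.
  have [/eqP[-> ->]|n1] := boolP ((c, d) == (i, i.+1)).
    by rewrite /nswap !eqxx; case: eqP => [?|_]; [lia | rewrite PiN andbF].
  have [/eqP[-> ->]|n2] := boolP ((c, d) == (i.+1, i)).
    by rewrite /nswap !eqxx; case: eqP => [?|_]; [lia | rewrite PiN eqxx andbF].
  rewrite Psw // andbT; case: (P c d) => //=; apply/eqP => -[e1 e2].
  case/eqP: n2; rewrite -(nswapK i i.+1 c) -(nswapK i i.+1 d) e1 e2 /nswap
    !eqxx.
  by case: eqP => // ?; lia.
rewrite /HL; have -> : rop1 t (i, i.+1) (word (iota 0 N) x)
    = rop t (word (iota 0 N) x) [:: (i, i.+1)] by [].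
rewrite -rop_cat; apply: rop_perm; apply: uniq_perm; rewrite ?rts_uniq //.
  rewrite cat_uniq rts_uniq /= andbT orbF mem_rts /P0 eqxx andbF /=.
  by rewrite !andbF.
move=> [c d]; rewrite mem_cat inE !mem_rts /P0.
case: (boolP ((c, d) == (i, i.+1))) => [/eqP[-> ->]|_].
  by rewrite i1N lt_iN Pi orbT.
by rewrite orbF andbT.
Qed.

Lemma HL_add N (P Q : rel nat) c d x g : (c < N)%N -> (d < N)%N -> P c d = false
  ->
    (forall a b, (a < N)%N -> (b < N)%N -> Q a b = P a b || ((a, b) == (c, d)))
      ->
  HL N Q x g = HL N P x g - t *: HL N P x (shift (c, d) g).
Proof. exact: rop_rts_add. Qed.

(** With all roots c < d, this is $B_\mu x$ for $\mu_i=g(i)+i$. *)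
Definition BB N x : (nat -> int) -> V := HL N ltn x.

Lemma BB_alt N x i : (i.+1 < N)%N -> alt i i.+1 (BB N x).
Proof.
move=> lt_iN; apply: HL_alt => //; first by rewrite /= ltnSn.
  by apply/negbTE; rewrite /= -leqNgt.
move=> c d _ _; rewrite !xpair_eqE /nswap => n1 n2.
by do !case: eqP => ?; lia.
Qed.

Lemma rop_linear (Phi Phi1 Phi2 : (nat -> int) -> V) (c : F) l :
    (forall g, Phi g = c *: Phi1 g + Phi2 g) ->
  forall g, rop t Phi l g = c *: rop t Phi1 l g + rop t Phi2 l g.
Proof.
move=> ePhi; elim: l => [|ab l IH] g //=.
rewrite /rop1 !IH scalerDr scalerBr opprD addrACA !scalerA.
by rewrite (mulrC t).
Qed.

Lemma BB_linear N c x y g : BB N (c *: x + y) g = c *: BB N x g + BB N y g.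
Proof. by apply: rop_linear => h; rewrite wordD wordZ. Qed.

Lemma BB_0 N g : BB N 0 g = 0.
Proof. by have := BB_linear N (-1) 0 0 g;
  rewrite scaler0 addr0 scaleN1r addNr. Qed.

Lemma BB_Z N c x g : BB N (c *: x) g = c *: BB N x g.
Proof. by have := BB_linear N c x 0 g; rewrite BB_0 !addr0. Qed.

(* The exponent vector of the word that starts at position m of g. *)
Definition tl m g : nat -> int := fun i => g (m + i)%N + m%:Z.

Definition blocks m (c d : nat) := (c < d)%N && ((d < m)%N || (m <= c)%N).

Lemma word_tl m n x g : word (iota 0 n) x (tl m g) = word (iota m n) x g.
Proof.
rewrite -(addn0 m) iotaDl /word foldr_map addn0.
elim: (iota 0 n) => //= i s ->; rewrite /tl; congr (b _ _); lia.
Qed.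

(** The roots of the inner product become roots among the positions from m on, and those of the
    outer product leave the tail of the exponent vector unchanged. The two sets of factors can
    therefore be applied in turn. *)
Lemma BB_cat m n x g : BB m (BB n x (tl m g)) g = HL (m + n) (blocks m) x g.
Proof.
pose up (cd : nat * nat) := ((m + cd.1)%N, (m + cd.2)%N).
have up_inj : injective up by move=> [c d] [c' d'] [] /addnI-> /addnI->.
have perm_b : perm_eq (rts (m + n) (blocks m))
                      (rts m ltn ++ map up (rts n ltn)).
  apply: uniq_perm; first exact: rts_uniq.
    rewrite cat_uniq rts_uniq map_inj_uniq // rts_uniq andbT /=.
    apply/hasPn => _ /mapP[[c d] _ ->]; rewrite mem_rts /=.
    by rewrite ltnNge leq_addr.
  move=> [c d]; rewrite mem_cat !mem_rts /blocks.
  have [lt_cm|le_mc] := ltnP c m.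
    rewrite (@negbTE ((c, d) \in map up _)) ?orbF.
      by rewrite /=; apply/idP/idP; lia.
    by apply/mapP => -[[c' d'] _ [e _]]; move: lt_cm; rewrite e ltnNge leq_addr.
  rewrite orbT andbT /=; have [lt_cd|le_dc] := ltnP c d; last first.
    rewrite !andbF; apply/esym/mapP => -[[c' d']];
      rewrite mem_rts => /and3P[_ _ cd'].
    by case=> e1 e2; move: cd' => /=; lia.
  have -> : (c, d) = up ((c - m)%N, (d - m)%N) by rewrite /up /= !subnKC //;
    lia.
  by rewrite mem_map // mem_rts /=; apply/idP/idP; lia.
rewrite [RHS]/HL (rop_perm _ _ perm_b) rop_cat.
have split_word h : word (iota 0 (m + n)) x h
    = word (iota 0 m) (word (iota 0 n) x (tl m h)) h.
  by rewrite iotaD add0n word_cat word_tl.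
have tl_shift cd h : tl m (shift (up cd) h) = shift cd (tl m h).
  apply: functional_extensionality => i; rewrite /tl /shift /= !eqn_add2l; lia.
(* Factors among the tail positions do not affect the indices of the first m operators, so they pass
   through the outer word by linearity. *)
have inner h : rop t (word (iota 0 (m + n)) x) (map up (rts n ltn)) h
    = word (iota 0 m) (BB n x (tl m h)) h.
  rewrite /BB /HL; elim: (rts n ltn) h => [|cd l IH] h /=;
    first exact: split_word.
  rewrite /rop1 !IH tl_shift.
  rewrite (@word_eq _ _ (shift _ h) h) => [|i].
    by rewrite -wordZ -wordN -wordD.
  rewrite mem_iota add0n /shift => lt_im.
  have /negPf-> : i != (m + cd.1)%N by lia.
  have /negPf-> : i != (m + cd.2)%N by lia.
  by rewrite addr0 subr0.
have tl_eq cd h : cd \in rts m ltn -> tl m (shift cd h) = tl m h.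
  case: cd => c d; rewrite mem_rts => /and3P[cm dm _].
  apply: functional_extensionality => i; rewrite /tl /shift /=.
  have /negPf-> : (m + i)%N != c by lia.
  have /negPf-> : (m + i)%N != d by lia.
  by rewrite addr0 subr0.
rewrite {1}/BB /HL; move: (BB n x) inner => Y inner.
have : {subset rts m ltn <= rts m ltn} by [].
elim: {1 3 4}(rts m ltn) g => [|cd l IH] g sub /=; first by rewrite inner.
have subl : {subset l <= rts m ltn} by move=> z zl; apply: sub;
  rewrite inE zl orbT.
by rewrite /rop1 -!IH // tl_eq // sub ?mem_head.
Qed.

(** The last operator has index 0 and acts trivially. A root (c, N) makes that index negative, and
    no root raises it again, so the corresponding term is zero and only the roots among the first N
    rows remain. *)
Lemma BB_pad N x g : b 0 x = x -> (forall n : int, n < 0 -> b n x = 0) ->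
  g N + N%:Z = 0 -> BB N.+1 x g = BB N x g.
Proof.
move=> b0 bN gN; rewrite /BB /HL.
have wordS h : word (iota 0 N.+1) x h = word (iota 0 N) (b (h N + N%:Z) x) h.
  by rewrite -[N.+1]addn1 iotaD add0n word_cat.
have word0 s h : word s 0 h = 0 by rewrite -(scale0r 0) wordZ !scale0r.
move: (word (iota 0 N.+1) x) wordS => W wordS.
have rN l h : all (fun cd => cd.1 != N) l -> h N + N%:Z < 0 ->
    rop t W l h = 0.
  elim: l h => [|[c d] l IH] h /=; first by move=> _ hN;
    rewrite wordS bN ?word0.
  case/andP => cN lN hN; rewrite /rop1 !IH ?scaler0 ?subr0 //.
  by rewrite /shift /= eq_sym (negPf cN); lia.
have r0 l h : all (fun cd => cd.1 != N) l -> h N + N%:Z = 0 ->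
    rop t W l h
    = rop t (word (iota 0 N) x) [seq cd <- l | cd.2 != N] h.
  elim: l h => [|[c d] l IH] h /=; first by move=> _ hN; rewrite wordS hN b0.
  case/andP => cN lN hN; rewrite /rop1 IH //; case: eqP => /= [->|/eqP dN].
    rewrite rN ?scaler0 ?subr0 // /shift /= eq_sym (negPf cN) eqxx; lia.
  by rewrite /rop1 IH // /shift /= ![N == _]eq_sym (negPf cN) (negPf dN); lia.
rewrite r0 //; last first.
  by apply/allP => -[c d]; rewrite mem_rts /= => /and3P[_ dN cd]; lia.
apply: (congr1 (fun f => f g)); apply: rop_perm.
apply: uniq_perm; first by apply/filter_uniq/rts_uniq.
  exact: rts_uniq.
move=> [c d]; by rewrite mem_filter !mem_rts /=; apply/idP/idP; lia.
Qed.

End Words.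

(** * Exchanging rows with a rectangle *)

Section Rectangle.
Variables (F : fieldType) (t : F) (V : lmodType F) (b : int -> V -> V).
Hypothesis F0 : [pchar F] =i pred0.
Hypothesis bD : forall n x y, b n (x + y) = b n x + b n y.
Hypothesis bZ : forall n c x, b n (c *: x) = c *: b n x.
Hypothesis b_quad : forall (i j : int) x,
  b i (b j x) - t *: b (i + 1) (b (j - 1) x)
    = - (b (j - 1) (b (i + 1) x) - t *: b j (b i x)).
Variables (m n : nat) (x : V) (g : nat -> int) (l : int).
Hypothesis le_nm : (n <= m)%N.
Hypothesis g_rect : forall i, (i < m)%N -> g i = l - i%:Z.

Let N := (m + n)%N.
Let HLx := HL t b N ^~ x.

(** Besides the roots internal to the two blocks, row d of the second block is joined to the rows of
    the rectangle from the threshold [th d] on. *)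
Let C (th : nat -> nat) (c d : nat) :=
  blocks m c d || [&& (c < m)%N, (m <= d)%N & (th d <= c)%N].

Let upd (th : nat -> nat) d0 c d := if d == d0 then c else th d.

Lemma HL_ext (P Q : rel nat) :
    (forall c d, (c < N)%N -> (d < N)%N -> P c d = Q c d) ->
  HLx P = HLx Q.
Proof. by move=> PQ; apply/rop_perm/eq_rts. Qed.

(* Adding the root (c, d0) changes nothing, since the corresponding term has two
   equal exponents in the rows c - 1 and c, which the root set does not
   distinguish. *)
Lemma lower_step th d0 c : th d0 = c.+1 -> (0 < c < m)%N -> (m <= d0 < N)%N ->
    (forall d, (m <= d < N)%N -> th d != c) ->
  HLx (C th) g = HLx (C (upd th d0 c)) g.
Proof.
case: c => // c th0 /andP[_ cm] /andP[m_d0 d0N] th_c.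
have cN : (c.+1 < N)%N by rewrite (leq_trans cm) // leq_addr.
have d0c : (d0 == c.+1) = false by lia.
have d0c' : (d0 == c) = false by lia.
rewrite /HLx (@HL_add F t V b N (C th) (C (upd th d0 c.+1)) c.+1 d0) //;
  first last.
- move=> a d aN dN; rewrite /C /upd xpair_eqE.
  case: (eqVneq d d0) => [->|dd0]; last by rewrite andbF orbF.
  by rewrite th0 andbT m_d0 /= -orbA; congr (_ || _); apply/idP/idP; lia.
- by rewrite /C th0 ltnn !andbF orbF /blocks; apply/negbTE; lia.
rewrite [X in _ *: X](@alt_eq0 F V c c.+1) ?scaler0 ?subr0 //; last first.
  rewrite /shift /= eqxx ![_ == d0]eq_sym d0c d0c' !g_rect //; last exact: ltnW.
  by rewrite (_ : (c == c.+1) = false); lia.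
apply: HL_alt => //.
- by rewrite /C /blocks ltnSn cm.
- by rewrite /C /blocks; apply/negbTE; lia.
move=> a d aN dN; rewrite !xpair_eqE /C /blocks /nswap => n1 n2.
have := th_c d; rewrite dN andbT.
by do !case: eqP => ?; lia.
Qed.

(** The threshold descends one unit at a time. No other threshold may lie on the way, as
    [lower_step] requires. *)
Lemma lower_many k th d0 c : th d0 = (c + k)%N -> (0 < c)%N -> (c + k <= m)%N ->
    (m <= d0 < N)%N ->
    (forall d e, (m <= d < N)%N -> (c <= e < c + k)%N -> th d != e) ->
  HLx (C th) g = HLx (C (upd th d0 c)) g.
Proof.
elim: k th => [|k IH] th th0 c0 ckm d0N th_c.
  apply: (congr1 (fun f => f g)); apply: HL_ext => a d _ _; rewrite /C /upd.
  by case: eqP => // ->; rewrite th0 addn0.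
have h1 : th d0 = (c + k).+1 by rewrite th0 addnS.
have h2 : (0 < c + k < m)%N by lia.
have h3 d : (m <= d < N)%N -> th d != (c + k)%N by move=> dN; apply: th_c; lia.
have h4 : upd th d0 (c + k) d0 = (c + k)%N by rewrite /upd eqxx.
have h5 d e : (m <= d < N)%N -> (c <= e < c + k)%N -> upd th d0 (c + k) d != e.
  move=> dN ce; rewrite /upd; case: (d =P d0) => _; first by lia.
  by apply: th_c; lia.
rewrite (lower_step h1 h2 d0N h3) (IH _ h4 c0 _ d0N h5); last by lia.
apply: (congr1 (fun f => f g)); apply: HL_ext => a d _ _; rewrite /C /upd.
by case: eqP.
Qed.

(* At k = n the right-hand side no longer depends on M, since d >= m there. *)
Lemma lower_stair M k : (n <= M <= m)%N -> (k <= n)%N ->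
  HLx (C (fun=> M)) g
    = HLx (C (fun d => if (N - k <= d)%N then (N - d)%N else M)) g.
Proof.
move=> /andP[nM Mm]; elim: k => [|k IH] kn.
  apply: (congr1 (fun f => f g)); apply: HL_ext => a d _ dN.
  by rewrite /C ifF // subn0; apply/negbTE; rewrite -ltnNge.
(* The last k rows already have thresholds 1 to k and the others M, so the next row can descend from
   M to k + 1 without meeting another threshold. *)
pose th d := if (N - k <= d)%N then (N - d)%N else M.
have d0N : (m <= N - k.+1 < N)%N by rewrite /N; lia.
have h1 : th (N - k.+1)%N = (k.+1 + (M - k.+1))%N.
  by rewrite /th; case: ifP; rewrite /N; lia.
have h2 d e : (m <= d < N)%N -> (k.+1 <= e < k.+1 + (M - k.+1))%N -> th d != e.
  by rewrite /th /N => dN ce; case: ifP; lia.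
rewrite IH 1?ltnW // -/th (lower_many h1 _ _ d0N h2) //; last by lia.
apply: (congr1 (fun f => f g)); apply: HL_ext => a d _ dN; rewrite /C /upd.
case: eqP => [->|dk];
  first by rewrite leqnn (_ : (N - (N - k.+1) = k.+1)%N) //; lia.
by have -> : (N - k.+1 <= d)%N = (N - k <= d)%N by lia.
Qed.

Definition cross p q (c d : nat) := [&& (c < p)%N, (p <= d)%N & (d < q)%N].

(** The constant thresholds m, with no joining root, and n, with all roots from the last m - n rows
    of the rectangle, both descend to the same staircase. The root set for n is the union of
    [cross n m] and [blocks n]. *)
Lemma rect_exchange : HL t b N (blocks m) x g
  = rop t (HL t b N (blocks n) x) (rts N (cross n m)) g.
Proof.
have -> : HL t b N (blocks m) x = HLx (C (fun=> m)).
  by apply: HL_ext => c d _ _; rewrite /C /blocks; apply/idP/idP; lia.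
rewrite (@lower_stair m n) ?leqnn ?le_nm // /HLx.
have -> : HL t b N (C (fun d => if (N - n <= d)%N then (N - d)%N else m)) x
    = HL t b N (C (fun d => if (N - n <= d)%N then (N - d)%N else n)) x.
  by apply: HL_ext => c d _ _; rewrite /C /N addnK; case: (leqP m d);
    rewrite ?andbF.
rewrite -/(HLx _) -lower_stair ?leqnn ?le_nm // /HLx /HL -rop_cat.
apply: (congr1 (fun f => f g)); apply: rop_perm.
apply: (@perm_trans _ (rts N (fun c d => cross n m c d || blocks n c d))).
  by apply: eq_rts => c d cN dN; rewrite /C /cross /blocks; apply/idP/idP; lia.
by apply: rts_cat => c d cN dN; rewrite /cross /blocks; lia.
Qed.

End Rectangle.

(** * Vandermonde sums and the action of permutations *)

Section VandermondeSum.
Variable R : comRingType.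

Definition vdm k (a : 'I_k -> R) : R :=
  \sum_(s : 'S_k) (-1) ^+ s * \prod_i a i ^+ s i.

Lemma vdmE k (a : 'I_k -> R) :
  vdm a = \prod_(i < k) \prod_(j < k | (i < j)%N) (a j - a i).
Proof.
transitivity (\det (Vandermonde k (\row_i a i))^T).
  by apply: eq_bigr => s _; congr (_ * _); apply: eq_bigr => i _; rewrite !mxE.
rewrite det_tr det_Vandermonde.
by apply: eq_bigr => i _; apply: eq_bigr => j _; rewrite !mxE.
Qed.

(** Pairs inside the first group each yield a factor tau. The mixed pairs yield the differences that
    become the crossing factors. *)
Lemma vdm_split n r (u : 'I_n -> R) (v : 'I_r -> R) (tau : R) :
  vdm (fun i => match split i with inl i => tau * u i | inr j => v j end)
    = (\prod_(i < n) \prod_(j < n | (i < j)%N) tau) * (vdm u * vdm v)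
      * \prod_(i < n) \prod_(j < r) (v j - tau * u i).
Proof.
rewrite !vdmE big_split_ord /=.
have uE i : split (lshift r i) = inl i :> 'I_n + 'I_r by apply: (unsplitK (inl
  i)).
have vE j : split (rshift n j) = inr j :> 'I_n + 'I_r by apply: (unsplitK (inr
  j)).
rewrite [X in _ * X](_ : _ = \prod_(i < r) \prod_(j < r | (i < j)%N) (v j - v
  i)).
  rewrite [X in X * _](_ : _ = \prod_(i < n) ((\prod_(j < n | (i < j)%N) tau)
     * (\prod_(j < n | (i < j)%N) (u j - u i)) * \prod_(j < r) (v j - tau * u
       i))).
    by rewrite !big_split /=; ring.
  apply: eq_bigr => i _; rewrite big_split_ord /=; congr (_ * _).
    by rewrite -big_split; apply: eq_bigr => j _; rewrite !uE /= mulrBr.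
  apply: eq_big => j; first by rewrite (leq_trans (ltn_ord i)) ?leq_addr.
  by rewrite uE vE.
apply: eq_bigr => i _; rewrite big_split_ord /= big_pred0 ?mul1r => [|j].
  by apply: eq_big => j; [rewrite ltn_add2l | rewrite !vE].
by apply/negbTE; rewrite -leqNgt (leq_trans (ltnW (ltn_ord j))) ?leq_addr.
Qed.

End VandermondeSum.

Section PermAction.

Definition pact k (s : 'S_k) (i : nat) : nat :=
  if insub i is Some j then s j else i.

Lemma pactE k (s : 'S_k) (i : 'I_k) : pact s i = s i.
Proof. by rewrite /pact valK. Qed.

Lemma pact_lt k (s : 'S_k) i : (i < k)%N -> (pact s i < k)%N.
Proof. by move=> ik; rewrite -[i]/(val (Ordinal ik)) pactE. Qed.

(** The action of a permutation transported to the window of k positions starting at lo, and the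
    identity elsewhere. *)
Definition bact lo k (s : 'S_k) (c : nat) : nat :=
  if (lo <= c < lo + k)%N then (lo + pact s (c - lo))%N else c.

Lemma bact_in lo k (s : 'S_k) i : (i < k)%N -> bact lo s (lo + i) = (lo + pact s
  i)%N.
Proof. by move=> ik; rewrite /bact leq_addr ltn_add2l ik addKn. Qed.

Lemma bact_out lo k (s : 'S_k) c : ~~ (lo <= c < lo + k)%N -> bact lo s c = c.
Proof. by rewrite /bact => /negPf->. Qed.

Lemma bact1 lo k c : bact lo (1%g : 'S_k) c = c.
Proof.
rewrite /bact; case: ifP => // /andP[lo_c c_hi].
have ck : (c - lo < k)%N by lia.
by rewrite -[(c - lo)%N]/(val (Ordinal ck)) pactE perm1 /= subnKC.
Qed.

Lemma bactM lo k (p q : 'S_k) c : bact lo (p * q)%g c = bact lo q (bact lo p c).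
Proof.
rewrite {1 3}/bact; case: ifP => [/andP[lo_c c_hi]|cN];
  last by rewrite /bact cN.
have ck : (c - lo < k)%N by lia.
rewrite -[(c - lo)%N]/(val (Ordinal ck)) !pactE permM /bact leq_addr ltn_add2l.
by rewrite ltn_ord /= addKn pactE.
Qed.

Lemma bact_tperm lo k (i j : 'I_k) c :
  bact lo (tperm i j) c = nswap (lo + i) (lo + j) c.
Proof.
rewrite /bact; case: ifP => [/andP[lo_c c_hi]|cN]; last first.
  have := ltn_ord i; have := ltn_ord j; rewrite /nswap.
  by case: (c =P _) => [|_]; [lia | case: (c =P _) => //; lia].
have ck : (c - lo < k)%N by lia.
have cE : c = (lo + val (Ordinal ck))%N by rewrite /= subnKC.
rewrite -[(c - lo)%N]/(val (Ordinal ck)) pactE {2}cE /nswap !eqn_add2l !val_eqE.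
by case: tpermP => [->|->|/eqP/negPf-> /eqP/negPf->]; rewrite ?eqxx //;
  case: eqP => [->|].
Qed.

Variables (F : fieldType) (V : lmodType F).

Lemma alt_bact lo k (Psi : (nat -> int) -> V) (s : 'S_k) g :
    (forall i, (lo <= i)%N -> (i.+1 < lo + k)%N -> alt i i.+1 Psi) ->
  Psi (g \o bact lo s) = (-1) ^+ s *: Psi g.
Proof.
move=> aPsi; have [ts -> dts] := prod_tpermP s.
elim: ts dts g => [|[i j] ts IH] /= dts g.
  rewrite big_nil odd_perm1 scale1r; congr Psi.
  by apply: functional_extensionality => c /=; rewrite bact1.
have {dts}/andP[/= ij dts] := dts.
rewrite big_cons odd_permM odd_tperm; move: ij; rewrite /dpair /= => ij.
rewrite ij addTb; set p := (\prod_(_ <- _) _)%g.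
have -> : g \o bact lo (tperm i j * p)%g
    = (g \o bact lo p) \o nswap (lo + i) (lo + j).
  by apply: functional_extensionality => c /=; rewrite bactM bact_tperm.
have -> : alt (lo + i) (lo + j) Psi.
  have [lt_ij|lt_ji|eq_ij] := ltngtP i j; last by case/eqP: ij; apply: val_inj.
    by apply: (alt_range aPsi); rewrite ?leq_addr ltn_add2l.
  have a_ji : alt (lo + j) (lo + i) Psi.
    by apply: (alt_range aPsi); rewrite ?leq_addr ltn_add2l.
  move=> h; rewrite -a_ji; congr Psi; apply: functional_extensionality => c /=.
  by congr h; rewrite /nswap; do !case: eqP => //; lia.
rewrite IH // -scaleNr; congr (_ *: _).
by case: (odd_perm p); rewrite /= ?expr0 ?expr1 ?opprK.
Qed.

End PermAction.

(** * Expansion of the crossing factors over permutations *)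

Section CrossExpand.
Variables (F : fieldType) (t : F) (V : lmodType F) (A : comAlgType F).
Variables (X : nat -> A) (phi : A -> V) (Theta : (nat -> int) -> V).
Variables (n r : nat) (B0 B1 : int) (g : nat -> int).
Let m := (n + r)%N.

Definition pt (e : nat -> nat) (i : nat) : int :=
  if (i < n)%N then B0 + (e i)%:Z else if (i < n + r)%N then B1 + (e i)%:Z else
    g i.

Hypothesis phiD : forall x y, phi (x + y) = phi x + phi y.
Hypothesis phiZ : forall c x, phi (c *: x) = c *: phi x.
(* phi turns multiplication by X b - t X a into the factor 1 - t e_ab, up to a
   shift of the exponents. *)
Hypothesis phi_mono : forall e : nat -> nat,
  phi (\prod_(i < m) X i ^+ e i) = Theta (pt e).

(** In X b - t X a the two terms raise the exponent at b and at a respectively, so the second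
    differs from the first by $e_{ab}$. Each root thus shifts the reference exponent at its target
    by one, which [count] records. *)
Lemma phi_mono_rop l (e : nat -> nat) : all (fun ab => (ab.1 < m)%N && (ab.2 <
  m)%N) l ->
  phi ((\prod_(i < m) X i ^+ e i) * \prod_(ab <- l) (X ab.2 - t *: X ab.1))
    = rop t Theta l (pt (fun i => e i + count (fun ab => ab.2 == i) l)%N).
Proof.
elim: l e => [|[a b] l IH] e /=.
  move=> _; rewrite big_nil mulr1 phi_mono; congr Theta.
  by apply: functional_extensionality => i; rewrite /pt addn0.
case/andP => /andP[am bm] lm; rewrite big_cons /=.
have monoS c : (c < m)%N -> (\prod_(i < m) X i ^+ e i) * X c
    = \prod_(i < m) X i ^+ (e i + (c == i))%N.
  move=> cm; rewrite (bigD1 (Ordinal cm)) //= [RHS](bigD1 (Ordinal cm)) //=.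
  rewrite eqxx addn1 exprSr mulrAC; congr (_ * _); apply: eq_bigr => i.
  by rewrite -val_eqE /= eq_sym => /negPf->; rewrite addn0.
rewrite mulrA mulrBr mulrBl -scalerAr -scalerAl !monoS //.
have phiB x c y : phi (x - c *: y) = phi x - c *: phi y.
  by rewrite -(scaleNr c y) phiD phiZ scaleNr.
rewrite phiB (IH (fun i => e i + (b == i))%N) //.
rewrite (IH (fun i => e i + (a == i))%N) // /rop1.
congr (rop _ _ _ _ - _ *: rop _ _ _ _).
  by apply: functional_extensionality => i; rewrite /pt addnA.
apply: functional_extensionality => i; rewrite /pt /shift /= ![i == _]eq_sym.
case: (ltnP i n) => i_n; first by lia.
case: (ltnP i (n + r)) => i_m; first by lia.
have /negPf-> : a != i by apply: contraTneq am => ->; rewrite -leqNgt.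
have /negPf-> : b != i by apply: contraTneq bm => ->; rewrite -leqNgt.
by rewrite addr0 subr0.
Qed.

Let L := [seq (i, n + j)%N | i <- iota 0 n, j <- iota 0 r].

Lemma cross_perm N : (m <= N)%N -> perm_eq (rts N (cross n m)) L.
Proof.
move=> mN; apply: uniq_perm; first exact: rts_uniq.
  apply: allpairs_uniq; rewrite ?iota_uniq // => -[a b] [c d] _ _ /=.
  by case=> -> /addnI->.
move=> [a b]; rewrite mem_rts /cross; apply/idP/allpairsP.
  move=> ab; exists (a, b - n)%N; rewrite /= !mem_iota !add0n.
  by split; rewrite ?subnKC //; rewrite /m in ab *; lia.
move=> [[c d] [/=]]; rewrite !mem_iota !add0n => cn dr [-> ->].
by rewrite /m in mN *; lia.
Qed.

Lemma iota0E k : iota 0 k = index_iota 0 k.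
Proof. by rewrite /index_iota subn0. Qed.

Lemma cross_count i : (i < m)%N ->
  count (fun ab => ab.2 == i) L = if (i < n)%N then 0%N else n.
Proof.
move=> im; rewrite -sum1_count big_mkcond /= /L big_allpairs_dep /=.
have cst k : (\sum_(0 <= a < n) k = n * k)%N by rewrite sum_nat_const_nat subn0.
have inner : (\sum_(j <- iota 0 r) (if (n + j == i)%N then 1 else 0) = (n <=
  i))%N.
  rewrite -big_mkcond /=; case: leqP => [ni|lt_in].
    rewrite (eq_bigl (fun j => j == i - n)%N) => [|j]; last by apply/eqP/eqP;
      lia.
    rewrite -big_filter filter_pred1_uniq ?iota_uniq ?big_seq1 //.
    by rewrite mem_iota add0n; rewrite /m in im; lia.
  by rewrite big_pred0 // => j; apply/eqP; lia.
rewrite (eq_bigr (fun=> (n <= i)%N : nat)) => [|a _]; last exact: inner.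
by rewrite (iota0E n) cst; case: leqP; rewrite ?muln1 ?muln0.
Qed.

Hypothesis t0 : t != 0.
Hypothesis F0 : [pchar F] =i pred0.
Hypothesis alt1 : forall i, (i.+1 < n)%N -> alt i i.+1 Theta.
Hypothesis alt2 : forall i, (n <= i)%N -> (i.+1 < m)%N -> alt i i.+1 Theta.

Lemma rop_cross_alt N i : (m <= N)%N -> i.+1 != n -> (i.+1 < m)%N ->
  alt i i.+1 (rop t Theta (rts N (cross n m))).
Proof.
move=> mN i_n i_m; apply: rop_rts_alt.
- by case: (ltnP i n) => i_n'; [apply: alt1; lia | apply: alt2].
- by lia.
- by lia.
by move=> a b _ _; rewrite /cross /nswap; do !case: eqP; lia.
Qed.

(* Both sides are images under phi of the Vandermonde determinant in the variables
   t X_0, ..., t X_(n-1), X_n, ..., X_(m-1): as a product, averaged over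
   S_n x S_r, and as a sum over S_m. *)
Lemma cross_expand N : (m <= N)%N -> exists c : 'S_m -> F,
  rop t Theta (rts N (cross n m))
    (pt (fun i => if (i < n)%N then i else (i - n) + n)%N)
  = \sum_(s : 'S_m) c s *: Theta (pt (pact s)).
Proof.
move=> mN; pose u (i : 'I_n) := X i; pose v (j : 'I_r) := X (n + j)%N.
pose Q := \prod_(ab <- L) (X ab.2 - t *: X ab.1).
pose Psi := rop t Theta (rts N (cross n m)).
pose e1 i := (if (i < n)%N then i else (i - n) + n)%N.
pose T : F := \prod_(i < n) \prod_(j < n | (i < j)%N) t.
have PsiE (e : nat -> nat) : phi ((\prod_(i < m) X i ^+ e i) * Q)
    = Psi (pt (fun i => e i + (if (i < n)%N then 0 else n))%N).
  rewrite (phi_mono_rop e); last first.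
    apply/allP => -[a b] /allpairsP[[c d] [/=]].
    by rewrite !mem_iota !add0n => cn dr [-> ->] /=; rewrite /m; lia.
  rewrite /Psi (rop_perm _ _ (cross_perm mN)); congr rop.
  apply: functional_extensionality => i; rewrite /pt.
  case: (ltnP i n) => i_n; first by rewrite cross_count ?i_n // /m ltn_addr.
  by case: (ltnP i (n + r)) => i_m //; rewrite cross_count // ltnNge i_n.
pose eb (s : 'S_n) (s' : 'S_r) i := if (i < n)%N then pact s i else pact s' (i -
  n).
have ebE (s : 'S_n) (s' : 'S_r) : (\prod_i u i ^+ s i) * (\prod_j v j ^+ s' j)
    = \prod_(i < m) X i ^+ eb s s' i.
  rewrite /m big_split_ord /=; congr (_ * _); apply: eq_bigr => i _.
    by rewrite /eb ltn_ord pactE.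
  by rewrite /eb ltnNge leq_addr /= addKn pactE.
(* Permuting exponents inside a group only costs a sign, since the crossing roots are stable under
   such permutations. All monomials thus lead to one vector, and the sign cancels that of the
   determinant. *)
have PsiS (s : 'S_n) (s' : 'S_r) : phi ((\prod_(i < m) X i ^+ eb s s' i) * Q)
    = ((-1) ^+ s * (-1) ^+ s') *: Psi (pt e1).
  rewrite PsiE -scalerA -(@alt_bact _ _ n r) => [|i ni im]; last first.
    by apply: rop_cross_alt; rewrite ?gtn_eqF.
  rewrite -(@alt_bact _ _ 0 n) => [|i _ i_n]; last first.
    by apply: rop_cross_alt; rewrite ?ltn_eqF // /m; rewrite add0n in i_n; lia.
  congr Psi; apply: functional_extensionality => i; rewrite /=.
  have [i_n|n_i] := ltnP i n.
    have -> : bact 0 s i = pact s i by rewrite -{1}[i]add0n bact_in.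
    have si_n := pact_lt s i_n.
    have -> : bact n s' (pact s i) = pact s i by rewrite bact_out //; lia.
    by rewrite /pt /eb /e1 i_n si_n addn0.
  have -> : bact 0 s i = i by rewrite bact_out //; lia.
  have [i_m|m_i] := ltnP i (n + r); last first.
    have -> : bact n s' i = i by rewrite bact_out //; lia.
    by rewrite /pt !ltnNge n_i m_i.
  have i_r : (i - n < r)%N by lia.
  rewrite -{2}(subnKC n_i) bact_in // /pt /eb /e1 ltnNge n_i i_m.
  rewrite ltnNge leq_addr ltn_add2l (pact_lt s' i_r) /= addKn.
  by [].
have T0 : T != 0.
  by rewrite prodf_seq_neq0; apply/allP => i _ /=; rewrite prodf_seq_neq0;
    apply/allP => j _; apply/implyP.
have phi_sum (I : finType) (G : I -> A) : phi (\sum_i G i) = \sum_i phi (G i).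
  by apply: (big_morph phi phiD); rewrite -(scale0r 0) phiZ scale0r.
have signZ (b : bool) (x : A) : (-1) ^+ b * x = (-1) ^+ b *: x.
  by case: b; rewrite ?expr0 ?expr1 ?mul1r ?scale1r // mulN1r scaleN1r.
pose w (i : 'I_(n + r)) := match split i with inl i => t%:A * u i | inr j => v j
  end.
(* Product form: n! r! equal contributions, times the power [T] of t coming from the pairs in the
   first group. *)
have E1 : phi (vdm w) = (T * (n`!)%:R * (r`!)%:R) *: Psi (pt e1).
  rewrite vdm_split.
  have -> : \prod_(i < n) \prod_(j < r) (v j - t%:A * u i) = Q.
    rewrite /Q big_allpairs_dep /= (iota0E n) big_mkord.
    apply: eq_bigr => i _; rewrite (iota0E r) big_mkord.
    by apply: eq_bigr => j _; rewrite mulr_algl.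
  have -> : \prod_(i < n) \prod_(j < n | (i < j)%N) (t%:A : A) = T%:A.
    rewrite -[T%:A]/(in_alg A T) rmorph_prod; apply: eq_bigr => i _.
    by rewrite rmorph_prod.
  rewrite -mulrA mulr_algl phiZ -!scalerA; congr (_ *: _).
  rewrite /vdm mulr_suml mulr_suml phi_sum.
  transitivity (\sum_(s : 'S_n) (r`!)%:R *: Psi (pt e1)).
    apply: eq_bigr => s _; rewrite mulr_sumr mulr_suml phi_sum.
    transitivity (\sum_(s' : 'S_r) Psi (pt e1)).
      apply: eq_bigr => s' _;
        rewrite !signZ -!scalerAl -!scalerAr -scalerAl !phiZ ebE PsiS.
      rewrite !scalerA mulrACA -!expr2 !sqrr_sign mulr1; exact: scale1r.
    by rewrite sumr_const card_Sn scaler_nat.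
  by rewrite sumr_const card_Sn -scaler_nat.
(* Sum form: the first n variables carry a factor t, which gathers into a power of t depending on
   s. *)
have E2 : phi (vdm w)
    = \sum_(s : 'S_m) ((-1) ^+ s * t ^+ (\sum_(i < n) s (lshift r i))) *: Theta
      (pt (pact s)).
  rewrite /vdm phi_sum; apply: eq_bigr => s _.
  rewrite signZ phiZ -scalerA; congr (_ *: _).
  rewrite -(phi_mono (pact s)) -phiZ; congr phi.
  rewrite /m !big_split_ord /= scalerAl; congr (_ * _).
    rewrite expr_sum -scaler_prod; apply: eq_bigr => i _.
    rewrite /w (unsplitK (inl i)) mulr_algl exprZn; congr (_ *: _ ^+ _).
    by rewrite -[nat_of_ord i]/(nat_of_ord (lshift r i)) pactE.
  apply: eq_bigr => j _; rewrite /w (unsplitK (inr j)); congr (_ ^+ _).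
  by rewrite -[(n + j)%N]/(nat_of_ord (rshift n j)) pactE.
pose K := T * (n`!)%:R * (r`!)%:R.
have K0 : K != 0.
  by move/pcharf0P: F0 => F0'; rewrite /K !mulf_neq0 // F0' -lt0n fact_gt0.
exists (fun s : 'S_m => K^-1 * ((-1) ^+ s * t ^+ (\sum_(i < n) s (lshift r
  i)))).
apply: (scalerI K0); rewrite -E1 E2 scaler_sumr; apply: eq_bigr => s _.
by rewrite scalerA mulVKf.
Qed.

End CrossExpand.

Section LinearExtension.
Variables (F : fieldType) (V : lmodType F) (G : {cmonom nat} -> V).
Implicit Types p q : Lam F.

(** The linear map with prescribed values on monomials. It provides the map [phi] of [cross_expand],
    with monomials read as exponent vectors. *)
Definition linext p : V := \sum_(k <- msupp p) p@_k *: G k.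

Lemma linextEw (d : {fset {cmonom nat}}) p : (msupp p `<=` d)%fset ->
  linext p = \sum_(k <- d) p@_k *: G k.
Proof.
move=> le_pd; rewrite /linext (big_fset_incl _ le_pd) // => k _ kNp.
by rewrite (mcoeff_outdom kNp) scale0r.
Qed.

Lemma linextD p q : linext (p + q) = linext p + linext q.
Proof.
rewrite (linextEw (msuppD_le p q)) (linextEw (fsubsetUl (msupp p) (msupp q))).
rewrite (linextEw (fsubsetUr (msupp p) (msupp q))) -big_split.
by apply: eq_bigr => k _; rewrite /= -scalerDl; congr (_ *: _); apply: mcoeffD.
Qed.

Lemma linextZ c p : linext (c *: p) = c *: linext p.
Proof.
rewrite (linextEw (msuppZ_le c p)) /linext scaler_sumr.
by apply: eq_bigr => k _; rewrite scalerA; congr (_ *: _); apply: mcoeffZ.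
Qed.

Lemma linextU k : linext << k >> = G k.
Proof. by rewrite (linextEw msuppU_le) big_seq_fset1 mcoeffUU scale1r. Qed.

End LinearExtension.

Section Exchange.
Variables (F : fieldType) (t : F) (V : lmodType F) (b : int -> V -> V).
Hypothesis F0 : [pchar F] =i pred0.
Hypothesis t0 : t != 0.
Hypothesis bD : forall n x y, b n (x + y) = b n x + b n y.
Hypothesis bZ : forall n c x, b n (c *: x) = c *: b n x.
Hypothesis b_quad : forall (i j : int) x,
  b i (b j x) - t *: b (i + 1) (b (j - 1) x)
    = - (b (j - 1) (b (i + 1) x) - t *: b j (b i x)).

(** The exponents of a rectangle decrease by one from row to row, while [cross_expand] starts from
    increasing ones. The two bases are chosen so that reversing each group passes from one to the
    other, at the cost of the signs of the two reversals. *)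
Lemma rect_cross_expand (Theta : (nat -> int) -> V) n r (l : int) g N :
    (n + r <= N)%N ->
    (forall i, (i.+1 < n)%N -> alt i i.+1 Theta) ->
    (forall i, (n <= i)%N -> (i.+1 < n + r)%N -> alt i i.+1 Theta) ->
    (forall i, (i < n + r)%N -> g i = l - i%:Z) ->
  exists c : 'S_(n + r) -> F, rop t Theta (rts N (cross n (n + r))) g
    = \sum_(s : 'S_(n + r))
        c s *: Theta (pt n r (l - n%:Z + 1) (l - (n + r)%:Z - n%:Z + 1) g (pact
          s)).
Proof.
move=> mN alt1 alt2 gl; set B0 := l - n%:Z + 1;
  set B1 := l - (n + r)%:Z - n%:Z + 1.
have phi_mono (e : nat -> nat) :
    linext (fun k : {cmonom nat} => Theta (pt n r B0 B1 g k))
      (\prod_(i < n + r) psum F i.+1 ^+ e i) = Theta (pt n r B0 B1 g e).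
  rewrite (@prod_psum F _ _ (fun i : 'I_(n + r) => nat_of_ord i) (fun i => e
    i)).
  rewrite linextU; congr Theta; apply: functional_extensionality => i;
    rewrite /pt.
  have monI : (i < n + r)%N -> mon (index_enum _)
      (fun i : 'I_(n + r) => nat_of_ord i) (fun i => e i) i = e i.
    by move=> im; rewrite monE (big_pred1 (Ordinal im)).
  case: ltnP => i_n; first by rewrite monI // ltn_addr.
  by case: ltnP => // im; rewrite monI.
have [c cE] := @cross_expand F t V (Lam F) (fun i => psum F i.+1) _ Theta n r B0
  B1 g
  (linextD _) (linextZ _) phi_mono t0 F0 alt1 alt2 N mN.
pose rv k : 'S_k := perm (@rev_ord_inj k).
have rvE k i : (i < k)%N -> pact (rv k) i = (k - i.+1)%N.
  by move=> ik; rewrite -[i]/(nat_of_ord (Ordinal ik)) pactE permE.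
set e1 := (fun i : nat => _) in cE.
set Psi := rop _ _ _ in cE *.
have gE : g = (pt n r B0 B1 g e1 \o bact n (rv r)) \o bact 0 (rv n).
  apply: functional_extensionality => i /=.
  have [i_n|n_i] := ltnP i n.
    have -> : bact 0 (rv n) i = (n - i.+1)%N by rewrite -{1}[i]add0n bact_in //
      rvE.
    have -> : bact n (rv r) (n - i.+1) = (n - i.+1)%N by rewrite bact_out //;
      lia.
    have lt_n : (n - i.+1 < n)%N by lia.
    by rewrite /pt /e1 lt_n gl /B0; lia.
  have -> : bact 0 (rv n) i = i by rewrite bact_out //; lia.
  have [i_m|m_i] := ltnP i (n + r); last first.
    have -> : bact n (rv r) i = i by rewrite bact_out //; lia.
    by rewrite /pt !ltnNge n_i m_i.
  have i_r : (i - n < r)%N by lia.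
  have -> : bact n (rv r) i = (n + (r - (i - n).+1))%N.
    by rewrite -{1}(subnKC n_i) bact_in // rvE.
  have lt_m : (n + (r - (i - n).+1) < n + r)%N by lia.
  have n_lt : (n + (r - (i - n).+1) < n)%N = false by lia.
  by rewrite /pt /e1 n_lt lt_m gl // /B1; lia.
have sE : Psi g = ((-1) ^+ rv n * (-1) ^+ rv r) *: Psi (pt n r B0 B1 g e1).
  rewrite {1}gE (@alt_bact F V 0 n) => [|i _ i_n]; last first.
    by apply: rop_cross_alt => //; lia.
  rewrite (@alt_bact F V n r) ?scalerA // => i n_i i_m.
  by apply: rop_cross_alt => //; lia.
exists (fun s => ((-1) ^+ rv n * (-1) ^+ rv r) * c s).
by rewrite sE cE scaler_sumr; apply: eq_bigr => s _; rewrite scalerA.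
Qed.

(** The cut after n + r rows is moved by [rect_exchange] to a cut after n rows, the crossing factors
    are expanded, and [BB_cat] is read backwards. *)
Lemma BB_exchange n r (l : int) (g : nat -> int) x :
    (forall i, (i < n + r)%N -> g i = l - i%:Z) ->
  exists c : 'S_(n + r) -> F,
    BB t b (n + r) (BB t b n x (tl (n + r) g)) g
    = \sum_(s : 'S_(n + r))
        let h := pt n r (l - n%:Z + 1) (l - (n + r)%:Z - n%:Z + 1) g (pact s) in
        c s *: BB t b n (BB t b (n + r) x (tl n h)) h.
Proof.
move=> gl; pose Theta := HL t b (n + r + n) (blocks n) x.
have altT i : (i.+1 < n + r + n)%N -> i.+1 != n -> alt i i.+1 Theta.
  move=> lt_i i_n; apply: HL_alt => //.
  - by rewrite /blocks ltnSn /=; lia.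
  - by rewrite /blocks; lia.
  move=> c d cN dN; rewrite !xpair_eqE /blocks /nswap => n1 n2.
  by do !case: eqP => ?; lia.
have alt1 i : (i.+1 < n)%N -> alt i i.+1 Theta by move=> lt_i; apply: altT; lia.
have alt2 i : (n <= i)%N -> (i.+1 < n + r)%N -> alt i i.+1 Theta.
  by move=> le_i lt_i; apply: altT; lia.
have [c cE] := rect_cross_expand (leq_addr n (n + r)) alt1 alt2 gl.
exists c; rewrite BB_cat // (rect_exchange F0 bD bZ b_quad x _ gl) ?leq_addr //
  cE.
apply: eq_bigr => s _ /=; rewrite BB_cat // /Theta.
by rewrite (addnC n (n + r)).
Qed.

End Exchange.

(** * Straightening and k-splits *)

Section Straighten.
Variables (F : fieldType) (t : F) (V : lmodType F) (b : int -> V -> V).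
Hypothesis F0 : [pchar F] =i pred0.
Hypothesis bD : forall n x y, b n (x + y) = b n x + b n y.
Hypothesis bZ : forall n c x, b n (c *: x) = c *: b n x.
Hypothesis b_quad : forall (i j : int) x,
  b i (b j x) - t *: b (i + 1) (b (j - 1) x)
    = - (b (j - 1) (b (i + 1) x) - t *: b j (b i x)).
Variable x : V.

Lemma BB_eq N g g' : (forall i, (i < N)%N -> g i = g' i) ->
  BB t b N x g = BB t b N x g'.
Proof. exact: HL_eq. Qed.

Lemma BB_eq0 N g i j : (i < j < N)%N -> g i = g j -> BB t b N x g = 0.
Proof.
case/andP=> ij jN gij; apply: (alt_eq0 F0 _ gij).
apply: (@alt_range _ _ 0 N) => // i' _ lt_i'.
exact: BB_alt.
Qed.

Let BS (e : seq int) := BB t b (size e) x (nth 0 e).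

Lemma BS_swap p a c s : BS (p ++ [:: a, c & s]) = - BS (p ++ [:: c, a & s]).
Proof.
have lt_p : ((size p).+1 < size (p ++ [:: a, c & s]))%N by rewrite size_cat /=;
  lia.
have altp := BB_alt bD bZ b_quad x lt_p.
have sz : size (p ++ [:: c, a & s]) = size (p ++ [:: a, c & s]) by rewrite
  !size_cat.
rewrite /BS sz -altp; apply: BB_eq => i _ /=; rewrite !nth_cat /nswap.
case: (i =P size p) => [->|ip].
  by rewrite ltnn subnn [((size p).+1 < _)%N]ltnNge leqnSn /= subSnn.
case: (i =P (size p).+1) => [->|ip1].
  by rewrite ltnn subnn [((size p).+1 < _)%N]ltnNge leqnSn /= subSnn.
case: ltnP => // le_pi.
by have -> : (i - size p)%N = (i - (size p).+2).+2 by lia.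
Qed.

Lemma BS_perm e e' p : perm_eq e e' ->
  exists eps : bool, BS (p ++ e) = (-1) ^+ eps *: BS (p ++ e').
Proof.
elim: e e' p => [|a s IH] e' p ee'.
  by exists false; move: ee'; rewrite perm_sym => /perm_nilP->; rewrite scale1r.
have ae' : a \in e' by rewrite -(perm_mem ee') mem_head.
case/splitPr: ae' ee' => u v; rewrite perm_sym perm_catC /= perm_cons perm_catC.
rewrite perm_sym => /(IH _ (rcons p a))[eps]; rewrite !cat_rcons => ->.
have [eps' ->] : exists eps' : bool,
    BS (p ++ a :: u ++ v) = (-1) ^+ eps' *: BS (p ++ u ++ a :: v).
  elim: u p => [|c u IHu] p; first by exists false; rewrite scale1r.
  have [eps' e1] := IHu (rcons p c); exists (~~ eps').
  rewrite BS_swap; move: e1; rewrite !cat_rcons => ->.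
  by rewrite -scaleNr; case: eps'; rewrite ?expr1 ?expr0 ?opprK.
by exists (eps (+) eps'); rewrite scalerA signr_addb.
Qed.

(** A repeated exponent gives zero; otherwise sorting costs a sign. The lower bound on the exponents
    ensures that the sorted vector comes from nonnegative parts. *)
Lemma BB_straighten N g : (forall i, (i < N)%N -> 0 < g i + N%:Z) ->
  BB t b N x g = 0 \/ exists (mu : seq nat) (eps : bool),
    [/\ size mu = N, sorted geq mu,
        perm_eq [seq g i | i <- iota 0 N]
                [seq (nth 0%N mu i)%:Z - i%:Z | i <- iota 0 N]
      & BB t b N x g = (-1) ^+ eps *: BB t b N x (fun i => (nth 0%N mu i)%:Z -
        i%:Z)].
Proof.
move=> gN; pose e := [seq g i | i <- iota 0 N].
have sze : size e = N by rewrite size_map size_iota.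
have eE i : (i < N)%N -> nth 0 e i = g i.
  by move=> iN; rewrite (nth_map 0%N) ?size_iota // nth_iota.
have BSe : BB t b N x g = BS e.
  by rewrite /BS sze; apply: BB_eq => i iN; rewrite eE.
case: (boolP (uniq e)) => [ue|/(uniqPn 0)[i [j [ij je eij]]]]; last first.
  left; rewrite sze in je; apply: (@BB_eq0 _ _ i j); first by rewrite ij.
  by rewrite -!eE // (ltn_trans ij).
right; pose ge_int (y z : int) := z <= y.
pose e' := sort ge_int e.
have pe : perm_eq e e' by rewrite perm_sym perm_sort.
have sze' : size e' = N by rewrite size_sort.
have se' i : (i.+1 < N)%N -> nth 0 e' i.+1 < nth 0 e' i.
  move=> iN; rewrite lt_neqAle nth_uniq ?sze' ?sort_uniq // 1?ltnW //.
  rewrite neq_ltn ltnSn orbT /=.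
  have : sorted ge_int e' by apply: sort_sorted => y z; apply: le_total.
  by move/(sortedP 0); apply; rewrite sze'.
have e'N i : (i < N)%N -> 0 <= nth 0 e' i + i%:Z.
  move=> iN; have [k kE] : exists k, N = (i + k.+1)%N by exists (N - i.+1)%N;
    lia.
  (* The last sorted exponent is at least 1 - N and each earlier one is larger by at least one, so
     the entry at position i is at least -i. *)
  suff : - (N%:Z) + k.+1%:Z <= nth 0 e' i by lia.
  elim: k i iN kE => [|k IH] i iN kE.
    have : nth 0 e' i \in e by rewrite (perm_mem pe) mem_nth ?sze'.
    by case/mapP => j; rewrite mem_iota => jN ->; have := gN j jN; lia.
  have iN' : (i.+1 < N)%N by lia.
  by have := IH i.+1 iN'; have := se' _ iN'; lia.
pose mu := mkseq (fun i => absz (nth 0 e' i + i%:Z)) N.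
have muE i : (i < N)%N -> (nth 0%N mu i)%:Z - i%:Z = nth 0 e' i.
  by move=> iN; rewrite nth_mkseq //; have := e'N i iN; lia.
have [eps epsE] := BS_perm [::] pe.
exists mu, eps; split.
- by rewrite size_mkseq.
- apply/(sortedP 0%N) => i; rewrite size_mkseq => iN /=.
  have := muE i (ltnW iN); have := muE _ iN; have := se' i iN; lia.
- apply: (perm_trans pe); rewrite (_ : [seq _ | i <- iota 0 N] = e') //.
  apply: (@eq_from_nth _ 0); first by rewrite size_map size_iota.
  move=> i; rewrite size_map size_iota => iN.
  by rewrite (nth_map 0%N) ?size_iota // nth_iota // muE.
rewrite BSe epsE /BS !cat0s sze'; congr (_ *: _).
by apply: BB_eq => i iN; rewrite muE.
Qed.

End Straighten.

(** The bridge from the finite index types of [Bpart] to vectors on the naturals. Subtracting i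
    compensates for the position added in [word]. *)
Lemma foldr_BB (F : fieldType) (t : F) (V : lmodType F) (b : int -> V -> V)
    N (al0 : nat -> int) (x : V) :
  foldr (fun (ab : 'I_N * 'I_N) Phi (al : {ffun 'I_N -> int}) => Phi al
           - t *: Phi [ffun c => al c + (c == ab.1)%:R - (c == ab.2)%:R])
        (fun al => foldr (fun a => b (al a)) x (enum 'I_N))
        [seq ab : 'I_N * 'I_N <- enum {: 'I_N * 'I_N} | (ab.1 < ab.2)%N]
        [ffun a : 'I_N => al0 a]
    = BB t b N x (fun i => al0 i - i%:Z).
Proof.
pose ext (al : {ffun 'I_N -> int}) (i : nat) : int :=
  (if insub i is Some j then al j else 0) - i%:Z.
pose nat_pair (ab : 'I_N * 'I_N) := (nat_of_ord ab.1, nat_of_ord ab.2).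
have npi : injective nat_pair.
  by move=> [a c] [d e] [] /val_inj-> /val_inj->.
have wordE (al : {ffun 'I_N -> int}) :
    foldr (fun a => b (al a)) x (enum 'I_N) = word b (iota 0 N) x (ext al).
  rewrite /word -val_enum_ord foldr_map.
  elim: (enum 'I_N) => //= i s ->; congr (b _ _).
  by rewrite /ext valK subrK.
have ext_eop (a c : 'I_N) (al : {ffun 'I_N -> int}) :
    ext [ffun d => al d + (d == a)%:R - (d == c)%:R] = shift (nat_pair (a, c))
      (ext al).
  apply: functional_extensionality => i; rewrite /ext /shift /=.
  case: insubP => [j _ <-|]; first by rewrite ffunE -!val_eqE /=; lia.
  rewrite -leqNgt => N_i.
  have /negPf-> : i != a by rewrite neq_ltn (leq_trans (ltn_ord a)) ?orbT.
  have /negPf-> : i != c by rewrite neq_ltn (leq_trans (ltn_ord c)) ?orbT.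
  by rewrite addr0 subr0.
pose step (ab : 'I_N * 'I_N) (Phi : {ffun 'I_N -> int} -> V) al := Phi al
  - t *: Phi [ffun c => al c + (c == ab.1)%:R - (c == ab.2)%:R].
have foldE l al : foldr step (fun al => foldr (fun a => b (al a)) x (enum 'I_N))
  l al
    = rop t (word b (iota 0 N) x) (map nat_pair l) (ext al).
  elim: l al => [|[a c] l IH] al; first exact: wordE.
  by rewrite /= /rop1 /step !IH ext_eop.
rewrite [LHS]foldE /BB /HL.
have -> : rop t (word b (iota 0 N) x) (rts N ltn)
  = rop t (word b (iota 0 N) x)
      (map nat_pair [seq ab : 'I_N * 'I_N <- enum {: 'I_N * 'I_N} | (ab.1 <
        ab.2)%N]).
  apply: rop_perm; apply: uniq_perm; first exact: rts_uniq.
    by rewrite map_inj_uniq // filter_uniq // enum_uniq.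
  move=> [a c]; rewrite mem_rts; apply/idP/mapP.
    case/and3P => aN cN ac; exists (Ordinal aN, Ordinal cN) => //.
    by rewrite mem_filter mem_enum /= andbT.
  by case=> -[a' c']; rewrite mem_filter => /andP[/= ac _] [-> ->];
    rewrite !ltn_ord.
apply: (@rop_eq _ _ _ N) => [g g' gg'|i iN].
  by apply: word_eq => i; rewrite mem_iota add0n => /gg'.
by rewrite /ext insubT ffunE.
Qed.

Section Bpart.
Variables (F : fieldType) (t : F).
Hypothesis F0 : [pchar F] =i pred0.

Lemma BpartE (mu : seq nat) (f : Lam F) : Bpart t mu f
  = BB t (Bop t) (size mu) f (fun i => (nth 0%N mu i)%:Z - i%:Z).
Proof. exact (@foldr_BB F t (Lam F) (Bop t) (size mu) (fun i => (nth 0%N mu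
  i)%:Z) f). Qed.

Lemma Bpart_linear mu c (f g : Lam F) :
  Bpart t mu (c *: f + g) = c *: Bpart t mu f + Bpart t mu g.
Proof.
rewrite !BpartE; apply: BB_linear => n.
  by move=> x y; apply: BopD.
by move=> d x; apply: BopZ.
Qed.

Lemma Bpart_rcons0 w : Bpart t (rcons w 0%N) 1 = Bpart t w 1 :> Lam F.
Proof.
rewrite !BpartE size_rcons BB_pad //; first last.
- by rewrite nth_rcons ltnn eqxx; lia.
- by move=> n n_lt0; rewrite Bop_1 ?ltW // lt_eqF.
- by rewrite Bop_1.
- by move=> n d y; apply: BopZ.
apply: BB_eq => i iw.
by rewrite nth_rcons iw.
Qed.

Lemma Bpart_pad w z : Bpart t (w ++ nseq z 0%N) 1 = Bpart t w 1 :> Lam F.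
Proof.
elim: z => [|z IH]; first by rewrite cats0.
by rewrite -addn1 nseqD catA cats1 Bpart_rcons0.
Qed.

End Bpart.

(** * Blocks of k-splits and linear spans *)

Section KSplit.
Variables (F : fieldType) (t : F) (k : nat).

Lemma ksplit_fuel fuel mu : all (fun y => y <= k)%N mu -> (size mu <= fuel)%N ->
  ksplit_rec fuel k mu = ksplit k mu.
Proof.
have gen f1 f2 nu : all (fun y => y <= k)%N nu -> (size nu <= f1)%N ->
    (size nu <= f2)%N -> ksplit_rec f1 k nu = ksplit_rec f2 k nu.
  elim: f1 f2 nu => [|f1 IH] f2 [|y nu] //=; first by case: f2.
    by case: f2.
  case: f2 => // f2 /andP[yk ak]; rewrite !ltnS => s1 s2.
  rewrite /= (subSn yk) /=; congr (_ :: _); apply: IH.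
  - by apply/allP => z /mem_drop /(allP ak).
  - by rewrite size_drop (leq_trans (leq_subr _ _)).
  - by rewrite size_drop (leq_trans (leq_subr _ _)).
by move=> ak sf; apply: gen.
Qed.

Lemma Gk_block c nu : all (fun y => y <= k)%N (c ++ nu) -> c != [::] ->
  size c = (k.+1 - head 0 c)%N -> Gk t k (c ++ nu) = Bpart t c (Gk t k nu) :>
    Lam F.
Proof.
case: c => // y c ak _ /= sz; rewrite /Gk /ksplit /= -sz.
rewrite -[y :: c ++ nu]/((y :: c) ++ nu) take_size_cat // drop_size_cat //=.
rewrite ksplit_fuel ?size_cat ?leq_addl //.
by apply/allP => z zn; apply: (allP ak); rewrite inE mem_cat zn !orbT.
Qed.

Lemma Gk_short c : all (fun y => y <= k)%N c -> c != [::] ->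
  (size c <= k.+1 - head 0 c)%N -> Gk t k c = Bpart t c 1 :> Lam F.
Proof.
case: c => // y c ak _ /= sz; rewrite /Gk /ksplit /=.
rewrite take_oversize // drop_oversize //=.
by case: (size c).
Qed.

End KSplit.

Section Span.
Variables (F : fieldType) (V : lmodType F).
Implicit Types (P Q : V -> Prop) (f g : V).

Lemma span_mem P f : P f -> in_span P f.
Proof.
move=> Pf; exists [:: (1, f)]; split; last by rewrite big_seq1 scale1r.
by move=> cg; rewrite inE => /eqP->.
Qed.

Lemma span0 P : in_span P 0.
Proof. by exists [::]; split; rewrite ?big_nil. Qed.

Lemma spanD P f g : in_span P f -> in_span P g -> in_span P (f + g).
Proof.
move=> [s [Ps ->]] [s' [Ps' ->]]; exists (s ++ s'); split;
  last by rewrite big_cat.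
by move=> cg; rewrite mem_cat => /orP[/Ps|/Ps'].
Qed.

Lemma spanZ P c f : in_span P f -> in_span P (c *: f).
Proof.
move=> [s [Ps ->]]; exists [seq (c * cg.1, cg.2) | cg <- s]; split.
  by move=> _ /mapP[cg /Ps Pcg ->].
by rewrite scaler_sumr big_map; apply: eq_bigr => cg _; rewrite scalerA.
Qed.

Lemma span_sum P (I : finType) (G : I -> V) :
  (forall i, in_span P (G i)) -> in_span P (\sum_i G i).
Proof.
move=> PG; apply: (big_ind (in_span P)) => //; [exact: span0 | exact: spanD].
Qed.

Lemma span_trans P Q f : in_span P f -> (forall g, P g -> in_span Q g) ->
  in_span Q f.
Proof.
move=> [s [Ps ->]] PQ; elim: s Ps => [|cg s IH] Ps; first by rewrite big_nil;
  apply: span0.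
rewrite big_cons; apply: spanD.
  by apply/spanZ/PQ/Ps; rewrite mem_head.
by apply: IH => cg' cg's; apply: Ps; rewrite inE cg's orbT.
Qed.

End Span.

Lemma span_linear (F : fieldType) (V W : lmodType F) (P : V -> Prop)
    (Q : W -> Prop) (T : V -> W) f :
    (forall c g h, T (c *: g + h) = c *: T g + T h) ->
    (forall g, P g -> in_span Q (T g)) ->
  in_span P f -> in_span Q (T f).
Proof.
move=> Tlin PQ [s [Ps ->]].
have T0 : T 0 = 0 by have := Tlin (-1) 0 0;
  rewrite scaler0 addr0 scaleN1r addNr.
elim: s Ps => [|cg s IH] Ps; first by rewrite big_nil T0; apply: span0.
rewrite big_cons Tlin; apply: spanD.
  by apply/spanZ/PQ/Ps; rewrite mem_head.
by apply: IH => cg' cg's; apply: Ps; rewrite inE cg's orbT.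
Qed.


Lemma map_iota_perm_ex N (f g : nat -> int) i :
  perm_eq [seq f i | i <- iota 0 N] [seq g i | i <- iota 0 N] -> (i < N)%N ->
  exists2 i', (i' < N)%N & f i = g i'.
Proof.
move=> /perm_mem fg iN; have : f i \in [seq f i | i <- iota 0 N].
  by apply: map_f; rewrite mem_iota.
by rewrite fg => /mapP[i' + ->]; rewrite mem_iota => i'N; exists i'.
Qed.

Lemma sorted_geq_nth (mu : seq nat) i i' : sorted geq mu -> (i <= i')%N ->
  (nth 0%N mu i' <= nth 0%N mu i)%N.
Proof.
move=> s_mu; case: (ltnP i' (size mu)) => [i'N|Ni' _];
  last by rewrite (nth_default _ Ni').
rewrite leq_eqVlt => /orP[/eqP->//|ii'].
have geq_trans : transitive geq by move=> b a c ba cb; apply: leq_trans cb ba.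
by apply: (sorted_ltn_nth geq_trans) => //; rewrite inE // (ltn_trans ii').
Qed.

(** * A rectangle acting on one block *)

Section RectangleBlock.
Variables (F : fieldType) (t : F).
Hypothesis F0 : [pchar F] =i pred0.
Hypothesis t0 : t != 0.

(** Each term of [BB_exchange] either vanishes or straightens to a pair of partitions. The bounds on
    their last parts are what allows a further block to be placed below them. *)
Lemma rect_block (l n r : nat) (la : seq nat) (x : Lam F) :
    (0 < n)%N -> size la = n -> sorted geq la -> nth 0%N la 0 = (l + r)%N ->
  in_span (fun h => exists mu1 mu2 : seq nat,
     [/\ size mu1 = n, sorted geq mu1, nth 0%N mu1 0 = (l + r)%N
       & (maxn l (nth 0 la n.-1) <= nth 0 mu1 n.-1)%N]
     /\ [/\ size mu2 = (n + r)%N, sorted geq mu2, nth 0%N mu2 0 = l,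
            (minn l (nth 0 la n.-1) <= nth 0 mu2 (n + r).-1)%N
          & h = Bpart t mu1 (Bpart t mu2 x)])
  (Bpart t (nseq (n + r) l) (Bpart t la x)).
Proof.
move=> n0 sz_la s_la la0; set m := (n + r)%N.
pose g (i : nat) : int := if (i < m)%N then l%:Z - i%:Z
  else (nth 0%N la (i - m))%:Z - i%:Z.
have gl i : (i < n + r)%N -> g i = l%:Z - i%:Z by rewrite /g => ->.
have bD := @BopD F t; have bZ := @BopZ F t; have bq := @Bop_quad F t F0.
have -> : Bpart t (nseq m l) (Bpart t la x)
    = BB t (Bop t) m (BB t (Bop t) n x (tl m g)) g.
  rewrite !BpartE size_nseq sz_la.
  have -> : BB t (Bop t) n x (fun i => (nth 0%N la i)%:Z - i%:Z)
      = BB t (Bop t) n x (tl m g).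
    by apply: BB_eq => i iN; rewrite /tl /g ltnNge leq_addr /= addKn; lia.
  by apply: BB_eq => i im; rewrite nth_nseq im gl.
have [c ->] := BB_exchange F0 t0 bD bZ bq x gl.
apply: span_sum => s; set h := pt _ _ _ _ _ _; apply: spanZ.
have h1 i : (i < n)%N -> h i = l%:Z - n%:Z + 1 + (pact s i)%:Z.
  by rewrite /h /pt => ->.
have h2 i : (i < r)%N -> tl n h i = l%:Z - m%:Z + 1 + (pact s (n + i))%:Z.
  by move=> ir; rewrite /tl /h /pt ltnNge leq_addr /= ltn_add2l ir; lia.
have h3 i : (r <= i)%N -> tl n h i = (nth 0%N la (i - r))%:Z - i%:Z.
  move=> ri; rewrite /tl /h /pt ltnNge leq_addr /= ltn_add2l ltnNge ri /=.
  by rewrite /g ltn_add2l ltnNge ri /= subnDl; lia.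
have s_lt i : (i < m)%N -> (pact s i < m)%N by apply: pact_lt.
have pact_inj i i' : (i < m)%N -> (i' < m)%N -> pact s i = pact s i' -> i = i'.
  move=> im im'; rewrite -[i]/(nat_of_ord (Ordinal im)).
  by rewrite -[i']/(nat_of_ord (Ordinal im')) !pactE => /val_inj/perm_inj [].
(* The value m - 1 in one of the r rows kept from the rectangle gives the exponent l, which is also
   that of the first row of [la]; such a term is zero. *)
have [/existsP[i /eqP si]|/existsPn top] :=
    boolP [exists i : 'I_r, pact s (n + i)%N == m.-1].
  rewrite (BB_eq0 F0 bD bZ bq x (N := m) (g := tl n h) (i := i) (j := r)).
  - by rewrite (BB_0 t bD bZ); apply: span0.
  - by rewrite ltn_ord /= /m -[X in (X < _)%N]add0n ltn_add2r.
  - by rewrite h2 // si h3 // subnn la0 /m; lia.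
(* Otherwise the top value falls among the first n rows, where it forces the first part l + r of
   [mu1]. *)
have [i0 i0n si0] : exists2 i0, (i0 < n)%N & pact s i0 = m.-1.
  have lt_m : (m.-1 < m)%N by rewrite /m; lia.
  pose i0 := (s^-1)%g (Ordinal lt_m); exists (nat_of_ord i0); last first.
    by rewrite pactE permKV.
  rewrite ltnNge; apply/negP => n_i0; have := ltn_ord i0 => i0m.
  have ir : (i0 - n < r)%N by move: i0m; rewrite /m; lia.
  by have := top (Ordinal ir); rewrite /= subnKC // pactE permKV eqxx.
have [i i_m|->|[mu2 [e2 [sz2 s2 p2 ->]]]] := BB_straighten F0 bD bZ bq x (N :=
  m) (g := tl n h).
- have [ir|ri] := ltnP i r; first by rewrite h2 //; lia.
  by rewrite h3 //; lia.
- by rewrite (BB_0 t bD bZ); apply: span0.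
rewrite (BB_Z t bD bZ); apply: spanZ.
set y := BB _ _ m x _.
have [i i_n|->|[mu1 [e1 [sz1 s1 p1 ->]]]] := BB_straighten F0 bD bZ bq y (N :=
  n) (g := h).
- by rewrite h1 //; lia.
- exact: span0.
have m0 : (0 < m)%N by rewrite /m; lia.
have lt_m : (m.-1 < m)%N by rewrite prednK.
have lt_n : (n.-1 < n)%N by rewrite prednK.
have p2' := p2; have p1' := p1; rewrite perm_sym in p2';
  rewrite perm_sym in p1'.
have lt_rm : (r < m)%N by rewrite /m; lia.
have mu2_0 : nth 0%N mu2 0 = l.
  apply/eqP; rewrite eqn_leq; apply/andP; split.
    have [i im] := map_iota_perm_ex p2' m0; have [ir|ri] := ltnP i r.
      by rewrite h2 //; have := s_lt (n + i)%N;
        rewrite /m ltn_add2l => /(_ ir); lia.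
    by rewrite h3 //; have := sorted_geq_nth s_la (leq0n (i - r)); rewrite la0;
      lia.
  have [i im] := map_iota_perm_ex p2 lt_rm; rewrite h3 // subnn la0.
  by have := sorted_geq_nth s2 (leq0n i); lia.
have mu2_last : (minn l (nth 0 la n.-1) <= nth 0 mu2 m.-1)%N.
  have [i im] := map_iota_perm_ex p2' lt_m; have [ir|ri] := ltnP i r.
    by rewrite h2 //; have := geq_minl l (nth 0 la n.-1)%N; lia.
  rewrite h3 //; have i_n : (i - r <= n.-1)%N by move: im; rewrite /m; lia.
  by have := sorted_geq_nth s_la i_n; have := geq_minr l (nth 0 la n.-1)%N; lia.
have mu1_0 : nth 0%N mu1 0 = (l + r)%N.
  apply/eqP; rewrite eqn_leq; apply/andP; split.
    have [i i_n] := map_iota_perm_ex p1' n0; rewrite h1 //.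
    by have := s_lt i; rewrite /m (ltn_addr _ i_n) => /(_ isT); lia.
  have [i i_n] := map_iota_perm_ex p1 i0n; rewrite h1 // si0 /m.
  by have := sorted_geq_nth s1 (leq0n i); lia.
have mu1_last : (maxn l (nth 0 la n.-1) <= nth 0 mu1 n.-1)%N.
  have [i i_n] := map_iota_perm_ex p1' lt_n; rewrite h1 // => eqi.
  rewrite geq_max; apply/andP; split; first by lia.
  (* When the last part of [la] exceeds l, all parts of [mu2] equal l and its exponents fill an
     interval of length m. The point of that interval matching [pact s i] cannot come from the
     rectangle, as s is injective; it comes from a row of [la], whose part is a lower bound for the
     last part of [mu1]. *)
  have [|lt_l] := leqP (nth 0 la n.-1)%N l; first by lia.
  have im : (i < m)%N by rewrite /m ltn_addr.
  have im' : (m.-1 - pact s i < m)%N by lia.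
  have [i3 i3m] := map_iota_perm_ex p2' im'.
  have -> : nth 0%N mu2 (m.-1 - pact s i) = l.
    apply/eqP; rewrite eqn_leq -{1}mu2_0 sorted_geq_nth //=.
    apply: (leq_trans _ (sorted_geq_nth s2 (_ : _ <= m.-1)%N)); last by lia.
    by apply: leq_trans mu2_last; rewrite leq_min leqnn ltnW.
  have sim := s_lt i im; have [ir|ri] := ltnP i3 r.
    rewrite h2 // => e; have e' : pact s i = pact s (n + i3)%N by lia.
    have := pact_inj _ _ im _ e'; rewrite /m ltn_add2l => /(_ ir); lia.
  rewrite h3 // => e; have i_n' : (i3 - r <= n.-1)%N by move: i3m; rewrite /m;
    lia.
  by have := sorted_geq_nth s_la i_n'; lia.
apply/spanZ/span_mem; exists mu1, mu2; split; split => //.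
by rewrite !BpartE sz1 sz2.
Qed.
End RectangleBlock.

Lemma geq_trans : transitive geq.
Proof. by move=> b a c ba cb; apply: leq_trans cb ba. Qed.

Lemma is_part_cat c nu : sorted geq c -> 0%N \notin c -> is_part nu ->
  (head 0 nu <= nth 0 c (size c).-1)%N -> is_part (c ++ nu).
Proof.
move=> s_c c0 /andP[s_nu nu0] c_nu;
  rewrite /is_part mem_cat negb_or c0 nu0 andbT.
rewrite !(sorted_pairwise geq_trans) in s_c s_nu *.
rewrite pairwise_cat s_c s_nu !andbT; apply/allrelP => y z.
move=> /(nthP 0%N)[i ic <-] /(nthP 0%N)[i' i'nu <-] /=.
have le1 : (nth 0 c (size c).-1 <= nth 0 c i)%N.
  apply: sorted_geq_nth; first by rewrite (sorted_pairwise geq_trans).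
  by case: (size c) ic.
have le2 : (nth 0 nu i' <= nth 0 nu 0)%N.
  by apply: sorted_geq_nth => //; rewrite (sorted_pairwise geq_trans).
by rewrite (leq_trans le2) // nth0 (leq_trans c_nu).
Qed.

Lemma sorted_geq_zeros mu : sorted geq mu ->
  exists w z, mu = w ++ nseq z 0%N /\ 0%N \notin w.
Proof.
elim: mu => [|y mu IH] s_mu; first by exists [::], 0%N.
have [w [z [muE w0]]] := IH (path_sorted s_mu).
have [y0|y0] := eqVneq y 0%N; last first.
  by exists (y :: w), z; rewrite muE inE eq_sym negb_or y0.
exists [::], (size mu).+1; split => //=; rewrite y0; congr (_ :: _).
apply: (@eq_from_nth _ 0%N); rewrite ?size_nseq // => i imu;
  rewrite nth_nseq if_same.
by have := sorted_geq_nth s_mu (leq0n i.+1); rewrite y0 /=; lia.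
Qed.

Lemma is_part_drop n mu : is_part mu -> is_part (drop n mu).
Proof.
case/andP=> s_mu mu0;
  rewrite /is_part (subseq_sorted geq_trans (drop_subseq _ _)) //.
by apply: contra mu0; apply: mem_drop.
Qed.

Lemma part_all_le k mu : sorted geq mu -> (head 0 mu <= k)%N ->
  all (fun y => y <= k)%N mu.
Proof.
move=> s_mu mu_k; apply/(all_nthP 0%N) => i _; apply: leq_trans mu_k.
by rewrite -nth0 sorted_geq_nth.
Qed.

(** * Induction over the blocks of the k-split *)

Section RectangleG.
Variables (F : fieldType) (t : F).
Hypothesis F0 : [pchar F] =i pred0.
Hypothesis t0 : t != 0.

Lemma Omega_block k c nu : sorted geq c -> c != [::] -> 0%N \notin c ->
    (head 0 c <= k)%N -> size c = (k.+1 - head 0 c)%N -> is_part nu ->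
    (head 0 nu <= nth 0 c (size c).-1)%N ->
  Omega t k (head 0%N c) (Bpart t c (Gk t k nu)).
Proof.
move=> s_c c_n c0 ck sz p_nu nu_c; apply: span_mem; exists (c ++ nu).
have p_cnu := is_part_cat s_c c0 p_nu nu_c.
have hE : head 0%N (c ++ nu) = head 0%N c by case: (c) c_n.
split; rewrite ?hE // Gk_block //.
by case/andP: p_cnu => s_cnu _; apply: part_all_le; rewrite ?hE.
Qed.

Lemma rect_Gk k l mu : (1 <= l <= k)%N -> is_part mu -> (head 0 mu <= k)%N ->
  Omega t k (maxn (head 0%N mu) l) (Bpart t (nseq (k + 1 - l) l) (Gk t k mu)).
Proof.
move=> /andP[l1 lk]; have [N] := ubnP (size mu); elim: N mu => // N IH mu.
rewrite ltnS => szN p_mu mu_k; have [s_mu mu0] := andP p_mu.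
have [n' nE] : exists n', (k + 1 - l)%N = n'.+1 by exists (k - l)%N; lia.
(* If the first part of [mu] is at most l, the rectangle, of main hook-length k, is simply a new
   first block. *)
have [le_l|lt_l] := leqP (head 0%N mu) l.
  rewrite nE -[X in Omega _ _ X]/(head 0%N (nseq n'.+1 l)).
  apply: Omega_block => //.
  - apply/(sortedP 0%N) => i; rewrite size_nseq => i_n.
    by rewrite !nth_nseq i_n (ltnW i_n) /=.
  - by rewrite mem_nseq /= eq_sym -lt0n.
  - by rewrite size_nseq /=; lia.
  - by rewrite size_nseq nth_nseq /= ltnSn.
set j := head 0%N mu in lt_l mu_k *.
pose n := (k.+1 - j)%N; pose r := (j - l)%N.
have n0 : (0 < n)%N by rewrite /n; lia.
have nrE : (k + 1 - l)%N = (n + r)%N by rewrite /n /r; lia.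
(* The first block of [mu], completed by zeros to n rows when [mu] is too short; this is harmless
   because it then acts on 1. *)
pose la := take n mu ++ nseq (n - size mu) 0%N; pose rho := drop n mu.
have mu_n : mu != [::] by apply/eqP => e; move: lt_l; rewrite /j e.
have all_k := part_all_le s_mu mu_k.
have p_rho : is_part rho by apply: is_part_drop.
have sz_la : size la = n.
  by rewrite size_cat size_nseq size_take_min; lia.
have laE i : nth 0%N la i = if (i < n)%N then nth 0%N mu i else 0%N.
  rewrite nth_cat size_take_min nth_nseq if_same leq_min.
  case: (ltnP i n) => i_n //=; case: ltnP => i_mu; rewrite ?nth_take //.
  by rewrite nth_default.
have s_la : sorted geq la.
  apply/(sortedP 0%N) => i; rewrite sz_la => i_n.
  by rewrite /= !laE i_n (ltnW i_n) sorted_geq_nth.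
have la0 : nth 0%N la 0 = (l + r)%N by rewrite laE n0 nth0 -/j /r; lia.
have GkE : Gk t k mu = Bpart t la (Gk t k rho).
  have [le_n|lt_n] := leqP n (size mu).
    have -> : la = take n mu.
      by rewrite /la (_ : (n - size mu = 0)%N) ?cats0 //; lia.
    have hd : head 0%N (take n mu) = j by rewrite -nth0 nth_take ?nth0.
    have sz_t : size (take n mu) = n by rewrite size_take_min; lia.
    rewrite -{1}(cat_take_drop n mu) Gk_block ?cat_take_drop ?hd //.
    by rewrite -size_eq0 sz_t -lt0n.
  rewrite /rho drop_oversize 1?ltnW // /la take_oversize 1?ltnW //.
  rewrite (_ : Gk t k [::] = 1) // Bpart_pad // Gk_short //.
  by rewrite -/j -/n ltnW.
set q := nth 0%N la n.-1.
have rho_q : (head 0 rho <= q)%N.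
  rewrite /q laE prednK // leqnn -nth0 nth_drop addn0.
  by apply: sorted_geq_nth => //; lia.
have q_j : (q <= j)%N.
  by have := sorted_geq_nth s_la (leq0n n.-1); rewrite la0 -/q /r; lia.
rewrite GkE nrE.
apply: span_trans (rect_block F0 t0 (Gk t k rho) n0 sz_la s_la la0) _.
move=> f [mu1 [mu2 [[sz1 s1 h1 last1] [sz2 s2 h2 last2 ->]]]].
rewrite -/q in last1 last2.
have mu1_n : mu1 != [::] by rewrite -size_eq0 sz1 -lt0n.
have hd1 : head 0%N mu1 = j by rewrite -nth0 h1 /r subnKC // ltnW.
have mu1_0 : 0%N \notin mu1.
  apply/negP => /(nthP 0%N)[i]; rewrite sz1 => i_n e.
  have i_n' : (i <= n.-1)%N by rewrite -ltnS prednK.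
  have := leq_trans last1 (sorted_geq_nth s1 i_n').
  by rewrite e leqn0 => /eqP; move: l1; clear; lia.
have block nu : is_part nu -> (head 0 nu <= maxn l q)%N ->
    Omega t k j (Bpart t mu1 (Gk t k nu)).
  move=> p_nu nu_q; rewrite -hd1; apply: Omega_block; rewrite ?hd1 // sz1 //.
  exact: leq_trans last1.
have m0 : (0 < n + r)%N by rewrite addn_gt0 n0.
have hd2 : head 0%N mu2 = l by rewrite -nth0.
have mu2_n : mu2 != [::] by rewrite -size_eq0 sz2 -lt0n.
(* If l <= q, the bounds on its first and last parts force [mu2] to be the rectangle again, and the
   induction hypothesis applies to [rho]. *)
have [l_q|q_l] := leqP l q.
  have -> : mu2 = nseq (k + 1 - l) l.
    apply: (@eq_from_nth _ 0%N); first by rewrite sz2 size_nseq nrE.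
    move=> i; rewrite sz2 => i_m; rewrite nth_nseq nrE i_m.
    apply/eqP; rewrite eqn_leq -{1}h2 sorted_geq_nth //=.
    move: last2; rewrite (minn_idPl l_q) => /leq_trans; apply.
    by apply: sorted_geq_nth => //; rewrite -ltnS prednK.
  have rho_k : (head 0 rho <= k)%N by rewrite (leq_trans rho_q) // (leq_trans
    q_j).
  have sz_rho : (size rho < N)%N.
    rewrite size_drop; apply: leq_trans szN; rewrite ltn_subrL n0 lt0n size_eq0.
    exact: mu_n.
  have := IH rho sz_rho p_rho rho_k.
  apply: span_linear; first by move=> c g h; apply: Bpart_linear.
  move=> _ [nu [p_nu nu_k nu_h ->]]; apply: block => //.
  by rewrite nu_h geq_max (leq_trans rho_q) ?leq_maxl ?leq_maxr.
(* For 0 < q < l, the parts of [mu2] are at least q, hence at least those of [rho], so [mu2] is the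
   first block of the k-split of [mu2 ++ rho]. *)
have [q0|q0] := posnP q; last first.
  have mu2_0 : 0%N \notin mu2.
    apply/negP => /(nthP 0%N)[i]; rewrite sz2 => i_m e.
    have i_m' : (i <= (n + r).-1)%N by rewrite -ltnS prednK.
    have := leq_trans last2 (sorted_geq_nth s2 i_m').
    by rewrite e leqn0 => /eqP; move: l1 q0; clear; lia.
  have p2 : is_part (mu2 ++ rho).
    apply: is_part_cat => //; rewrite sz2 (leq_trans rho_q) //.
    by move: last2; rewrite (minn_idPr (ltnW q_l)).
  have hd2' : head 0%N (mu2 ++ rho) = l by rewrite -hd2; case: (mu2) mu2_n.
  have -> : Bpart t mu2 (Gk t k rho) = Gk t k (mu2 ++ rho).
    rewrite Gk_block //; last by rewrite hd2 sz2 -nrE addn1.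
    by case/andP: p2 => s2' _; apply: part_all_le; rewrite ?hd2'.
  by apply: block; rewrite // hd2' leq_maxl.
(* For q = 0 nothing remains below the block, so the trailing zeros of [mu2] can be removed, leaving
   a possibly short last block. *)
have rho0 : rho = [::].
  case/andP: p_rho => _; move: rho_q; rewrite q0.
  by case: (rho) => //= y s; rewrite leqn0 => /eqP->; rewrite mem_head.
have [w [z [mu2E w0]]] := sorted_geq_zeros s2.
have w_n : w != [::].
  apply/eqP => e; move: hd2; rewrite mu2E e.
  by case: (z) => [|z'] /= e0; move: l1; rewrite -e0.
have hdw : head 0%N w = l by rewrite -hd2 mu2E; case: (w) w_n.
have s_w : sorted geq w.
  by apply: (subseq_sorted geq_trans _ s2); rewrite mu2E prefix_subseq.
have -> : Bpart t mu2 (Gk t k rho) = Gk t k w.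
  rewrite rho0 (_ : Gk t k [::] = 1) // mu2E Bpart_pad // Gk_short //.
    by apply: part_all_le; rewrite ?hdw.
  by rewrite hdw -[k.+1]addn1 nrE -sz2 mu2E size_cat leq_addr.
by apply: block; rewrite ?hdw ?leq_maxl // /is_part s_w.
Qed.

End RectangleG.

Lemma tvar_neq0 : tvar != 0.
Proof. by rewrite /tvar tofrac_eq0 polyX_eq0. Qed.

Theorem theorem2 (k l j : nat) (hk : (0 < k)%N) (hl : (1 <= l <= k)%N)
    (hj : (j <= k)%N) (f : Lam Qqt) (hf : Omega tvar k j f) :
  Omega tvar k (maxn j l) (Bpart tvar (nseq (k + 1 - l) l) f).
Proof.
move: hf; apply: span_linear.
  by move=> c g h; apply: Bpart_linear.
move=> _ [mu [p_mu mu_k <- ->]].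
exact: (rect_Gk Qqt_char0 tvar_neq0 hl p_mu mu_k).
Qed.
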